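(* Let $\Phi:\mathbb R^+\to\mathbb R^+$ be an increasing convex function with $\Phi(0)=0$ and consider the probability measure $d\mu(x)=Z_\Phi^{-1}e^{-\Phi(|x|)}dx$ on $\mathbb R$. Assume that $\Phi$ is $C^2$ on $[\Phi^{-1}(1),\infty)$ and that $\sqrt\Phi$ is concave. Then there exists $c>0$ such that for all $n\ge1$, every $1$-Lipschitz function $h:\mathbb R^n\to\mathbb R$ is $\mu^{\otimes n}$-integrable and satisfies $$\mu^{\otimes n}\left(\left\{x:\ h(x)-\mu^{\otimes n}(h)\ge t\sqrt c\right\}\right)\le e^{-\sqrt2\,\Phi\left(\frac t2\right)}$$ provided $t\ge\max\left(2\Phi^{-1}(1),\ \frac{1}{\Phi'(\Phi^{-1}(1))}\right)$.
   Context: $Z_\Phi$ is the normalizing constant, $\mu^{\otimes n}$ the $n$-fold product measure on $\mathbb R^n$, $\mu^{\otimes n}(h)=\int h\,d\mu^{\otimes n}$, and Lipschitz is with respect to the Euclidean distance on $\mathbb R^n$. $\Phi'$ denotes the (right) derivative of $\Phi$. *)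

(* Defs.v *)
(* MathComp-Analysis; the reals are an arbitrary [R : realType]. *)
From HB Require Import structures.
From mathcomp Require Import all_boot all_order all_algebra.
From mathcomp Require Import all_classical all_reals all_analysis.

Set Implicit Arguments.
Unset Strict Implicit.
Unset Printing Implicit Defensive.
Import Order.TTheory GRing.Theory Num.Theory.
Import numFieldNormedType.Exports.

Local Open Scope classical_set_scope.
Local Open Scope ring_scope.

Section one_variable.
Context {R : realType}.
Implicit Types (f df Phi : R -> R) (D : set R) (a : R).

(* Functions on R^+ are total functions R -> R of which only the values on
   `[0, +oo[ matter. *)

Definition concave_function D f :=
  convex_function D (fun x => - f x).

Definition right_derivative f a : R :=
  lim ((fun h => h^-1 * (f (a + h) - f a)) @ 0^'+).

(* Difference quotients are restricted to points of [D], so at the endpoint of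
   a half-line the derivative is one-sided. *)
Definition derivative_on D f df :=
  forall x, D x ->
    (fun y => (f y - f x) / (y - x)) @ within D x^' --> df x.

Definition C2_on D f :=
  exists df ddf : R -> R,
    [/\ derivative_on D f df, derivative_on D df ddf
      & {within D, continuous ddf}].

(* The fallback value 0 is only taken outside the range of [Phi] on R^+. *)
Definition inverse_on_Rplus Phi : R -> R :=
  'pinv_(fun=> 0) (`[0, +oo[ : set R) Phi.

Definition Z_ Phi : R := \int[lebesgue_measure]_x expR (- Phi `|x|).

Definition mu_ Phi (A : set (measurableTypeR R)) : \bar R :=
  (\int[lebesgue_measure]_(x in A) ((Z_ Phi)^-1 * expR (- Phi `|x|))%:E)%E.

End one_variable.

Section product_power.
Context d (T : measurableType d) (R : realType).

Definition tuple_cons n (p : T * n.-tuple T) : n.+1.-tuple T :=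
  [tuple of p.1 :: p.2].

Lemma measurable_tuple_cons n : measurable_fun [set: _] (@tuple_cons n).
Proof.
exact: (measurable_cons (@measurable_fst _ _ T (n.-tuple T))
                        (@measurable_snd _ _ T (n.-tuple T))).
Qed.

HB.instance Definition _ n := isMeasurableFun.Build _ _ _ _ (@tuple_cons n)
  (@measurable_tuple_cons n).

(* n.-tuple T carries the product sigma-algebra; the n-fold product measure is
   built by transporting [P \x P^{(x) n}] along [tuple_cons]. *)
Fixpoint product_power (P : probability T R) n : probability (n.-tuple T) R :=
  match n with
  | 0 => [the probability _ _ of dirac ([tuple] : 0.-tuple T)]
  | m.+1 => [the probability _ _ of
      distribution [the probability _ _ of (P \x product_power P m)%E]
                   (@tuple_cons m)]
  end.

Lemma product_power_box (P : probability T R) n (A : 'I_n -> set T) :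
  (forall i, measurable (A i)) ->
  product_power P n [set x | forall i, A i (tnth x i)] =
  (\prod_(i < n) P (A i))%E.
Proof.
have mbox m (B : 'I_m -> set T) : (forall i, measurable (B i)) ->
    measurable [set x : m.-tuple T | forall i, B i (tnth x i)].
  move=> mB.
  have -> : [set x : m.-tuple T | forall i, B i (tnth x i)] =
      \bigcap_(i in [set: 'I_m]) ((@tnth m T ^~ i) @^-1` B i).
    by apply/seteqP; split => x /= Bx i => [_|]; exact: Bx.
  apply: fin_bigcap_measurable => [|i _]; first exact: finite_finset.
  by rewrite -[X in measurable X]setTI; exact: measurable_tnth.
elim: n A => [|n IH] A mA.
  rewrite big_ord0 /= diracE mem_set//.
  by case.
rewrite big_ord_recl -IH; last by move=> i; exact: mA.
have /(product_measure1E P (product_power P n) (mA ord0)) <- :=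
  mbox n (A \o lift ord0) (fun i => mA _).
rewrite /= /distribution /pushforward; congr (product_measure1 _ _ _).
apply/seteqP; split => -[x y] /=.
  move=> Axy; split; first exact: (Axy ord0).
  by move=> i; have := Axy (lift ord0 i); rewrite tnthS.
move=> [Ax Ay] i; have [->//|[j ->]] : i = ord0 \/ exists j, i = lift ord0 j.
  by case: (unliftP ord0 i) => [j ->|->]; [right; exists j|left].
by rewrite tnthS; exact: Ay.
Qed.

End product_power.

Section Rn.
Context {R : realType} (n : nat).
Implicit Types (x y : n.-tuple R).

Definition euclidean_dist x y : R :=
  Num.sqrt (\sum_(i < n) (tnth x i - tnth y i) ^+ 2).

Definition lipschitz1 (h : n.-tuple R -> R) :=
  forall x y, `|h x - h y| <= euclidean_dist x y.

End Rn.

(* Main.v *)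
Require Import Defs.
From HB Require Import structures.
From mathcomp Require Import all_boot all_order all_algebra.
From mathcomp Require Import all_classical all_reals all_analysis.
From mathcomp Require Import measurable_realfun ring lra.
Set Implicit Arguments.
Unset Strict Implicit.
Unset Printing Implicit Defensive.
Import Order.TTheory GRing.Theory Num.Theory.
Import numFieldNormedType.Exports.
Local Open Scope classical_set_scope.
Local Open Scope ring_scope.

(** Concentration is derived from an infimum-convolution inequality (Maurey's
    property tau) in its two-function form: for an explicit kernel [K] on the
    line, [F x * G y <= \prod_i K x_i y_i] for all [x] and [y] implies that the
    product of the integrals of [F] and [G] is at most 1. In this form the
    inequality passes to product measures by integrating out one coordinate
    after the other ([two_function_tensor]), with no loss in the dimension.

    In dimension one ([two_function_inequality]) a Prekopa-Leindler argument is
    used with a nonlinear midpoint. Write [P] for the distribution function and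
    [p] for the density. The midpoint of [x] and [y] is replaced by a mean
    [M x y] of [P x] and [P y], bounded by 1, such that the product of its
    partial derivatives is at least [K x y * p x * p y / 4]. If [a] and [b] are
    primitives of [F * p] and [G * p], then [a x * b y <= M x y ^+ 2]: at a
    maximum point of the quotient the two first-order conditions, multiplied
    together, show that the maximum is at most 1 ([product_primitives_le]).

    The kernel is at least the exponential of a cost of the variation of the
    logarithms of the tails of [mu] between [x] and [y], a cost that is
    quadratic near 0 and linear at infinity ([gain_ge_expR]). Convexity and
    [Phi 0 = 0] make [Phi] superadditive, and so these logarithms vary by at
    least [Phi (`|x - y| / 2)] and at least linearly in [`|x - y|]
    ([log_gap_ge]). Concavity of the square root of [Phi] makes [Phi]
    subquadratic; this is what allows one to add up the costs of the
    coordinates, and the sum is at least a multiple of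
    [Phi (euclidean_dist x y / 2) - 1] ([sum_cost_ge]).

    For a 1-Lipschitz function [h] with mean zero, the inequality is applied to
    multiples of [expR (l * h)] and [expR (- (l * h))]. The second integral is
    at least 1, so the first is bounded independently of the dimension
    ([lipschitz_laplace], [laplace_chernoff]). Choosing for [l] a secant slope of
    [Phi] in the Chernoff bound gives a tail of order
    [expR (- c2 * Phi (T / 4))]. At [T = t * C] with a large constant [C], the
    convexity of [Phi] and the inequality [1 <= Phi (t / 2)] absorb all
    constants. *)

(** * Convex functions with concave square root *)

Section growth.
Context {R : realType} (Phi : R -> R).
Implicit Types x y l k B s r : R.
Hypothesis Phi_ge0 : forall x : R, 0 <= x -> 0 <= Phi x.
Hypothesis Phi_incr : forall x y : R, 0 <= x -> x <= y -> Phi x <= Phi y.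
Hypothesis Phi_convex : convex_function (`[0, +oo[%classic : set R) Phi.
Hypothesis Phi0 : Phi 0 = 0.
Hypothesis sqrt_Phi_concave :
  concave_function `[0, +oo[ (fun x => Num.sqrt (Phi x)).

Lemma growth_scale_le l x : 0 <= l <= 1 -> 0 <= x -> Phi (l * x) <= l * Phi x.
Proof.
move=> l01 x0; pose t := Itv01 (proj1 (andP l01)) (proj2 (andP l01)).
have xP : x \in (`[0, +oo[%classic : set R) by rewrite inE/= in_itv/= x0.
have oP : 0 \in (`[0, +oo[%classic : set R) by rewrite inE/= in_itv/= lexx.
have := Phi_convex t xP oP.
by rewrite !convRE Phi0 mulr0 addr0 [X in Phi X <= _ -> _]convRE mulr0 addr0.
Qed.

(** Concavity of the square root makes [Phi x / x ^+ 2] nonincreasing. *)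
Lemma growth_scale_ge l x : 0 <= l <= 1 -> 0 <= x ->
  l ^+ 2 * Phi x <= Phi (l * x).
Proof.
move=> /andP[l0 l1] x0; pose t := Itv01 l0 l1.
have xP : x \in (`[0, +oo[%classic : set R) by rewrite inE/= in_itv/= x0.
have oP : 0 \in (`[0, +oo[%classic : set R) by rewrite inE/= in_itv/= lexx.
have := sqrt_Phi_concave t xP oP.
rewrite !convRE Phi0 sqrtr0 oppr0 [X in - Num.sqrt (Phi X) <= _ -> _]convRE.
rewrite !mulr0 !addr0/= mulrN lerN2.
move=> h; rewrite -[leRHS]sqr_sqrtr ?Phi_ge0 ?mulr_ge0//.
rewrite -[X in _ * X]sqr_sqrtr ?Phi_ge0// -exprMn lerXn2r ?nnegrE//.
by rewrite mulr_ge0 ?sqrtr_ge0.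
Qed.

Lemma growth_expand k x : 1 <= k -> 0 <= x -> k * Phi x <= Phi (k * x).
Proof.
move=> k1 x0; have k0 : 0 < k by lra.
have := @growth_scale_le k^-1 (k * x) _ (mulr_ge0 (ltW k0) x0).
rewrite invr_ge0 ltW//= invf_le1// k1 => /(_ isT).
by rewrite mulKf ?gt_eqF// ler_pdivlMl.
Qed.

Lemma growth_superadd x y : 0 <= x -> 0 <= y -> Phi x + Phi y <= Phi (x + y).
Proof.
move=> x0 y0; have := addr_ge0 x0 y0.
rewrite le0r => /orP[/eqP xy0|xy0].
  have [-> ->] : x = 0 /\ y = 0 by split; lra.
  by rewrite addr0 Phi0 addr0.
have h z : 0 <= z <= x + y -> Phi z <= z / (x + y) * Phi (x + y).
  move=> /andP[z0 zxy]; rewrite -[in Phi z](divfK (lt0r_neq0 xy0) z).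
  apply: growth_scale_le; last exact: ltW.
  by rewrite divr_ge0 ?(ltW xy0)//= ler_pdivrMr// mul1r.
apply: (le_trans (lerD (@h x _) (@h y _))); [lra|lra|].
by rewrite -!mulrDl divff ?gt_eqF// mul1r.
Qed.

(** The lower bound [(s / r) ^+ 2 * Phi r <= Phi s] keeps [Phi] from dropping
    quickly to the left of [r], and convexity bounds [Phi r] by the chord. *)
Lemma growth_lipschitz B s r : 0 < B -> 0 <= s -> s <= r -> r <= B ->
  Phi r - Phi s <= 2 * Phi B / B * (r - s).
Proof.
move=> B0 s0 sr rB; have [r0|r0] := leP r 0.
  have [-> ->] : r = 0 /\ s = 0 by split; lra.
  by rewrite !subrr mulr0.
have h1 : (s / r) ^+ 2 * Phi r <= Phi s.
  rewrite -[in leRHS](divfK (lt0r_neq0 r0) s).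
  apply: growth_scale_ge; last exact: ltW.
  by rewrite divr_ge0 ?(ltW r0)//= ler_pdivrMr// mul1r.
have h2 : Phi r <= r / B * Phi B.
  rewrite -[in leLHS](divfK (lt0r_neq0 B0) r).
  apply: growth_scale_le; last exact: ltW.
  by rewrite divr_ge0 ?(ltW B0) ?(ltW r0)//= ler_pdivrMr// mul1r.
have h3 : Phi r - Phi s <= 2 * (1 - s / r) * Phi r.
  have q0 := Phi_ge0 (ltW r0).
  suff : 0 <= (1 - s / r) ^+ 2 * Phi r by lra.
  by rewrite mulr_ge0// sqr_ge0.
apply: (le_trans h3); rewrite (_ : _ / B * (r - s) =
  2 * (1 - s / r) * (r / B * Phi B)); last by field; rewrite !gt_eqF.
by rewrite ler_wpM2l// mulr_ge0// subr_ge0 ler_pdivrMr// mul1r.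
Qed.

Lemma growth_continuous : continuous (fun x => Phi `|x|).
Proof.
move=> x; pose B := `|x| + 1; have B0 : 0 < B by rewrite /B ltr_wpDl.
have K0 : 0 <= 2 * Phi B / B by rewrite divr_ge0 ?mulr_ge0 ?Phi_ge0 ?ltW.
apply/cvgrPdist_le => e e0; pose K := 2 * Phi B / B + 1.
have Kp : 0 < K by rewrite /K; lra.
near=> y.
have yB : `|y| <= B.
  have : `|x - y| <= 1 by near: y; apply: cvgr_dist_le.
  by have := lerB_dist y x; rewrite /B distrC; lra.
have xB : `|x| <= B by rewrite /B; lra.
have xye : `|x - y| <= e / K by near: y; apply: cvgr_dist_le => //; exact: divr_gt0.
suff : `|Phi `|x| - Phi `|y| | <= 2 * Phi B / B * `| `|x| - `|y| |.
  move=> /le_trans; apply; apply: (@le_trans _ _ (K * (e / K))).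
    apply: ler_pM => //; first by rewrite /K; lra.
    exact: le_trans (ler_dist_dist _ _) xye.
  by rewrite mulrCA divff ?gt_eqF// mulr1.
have [xy|/ltW xy] := leP `|y| `|x|.
  rewrite [X in X <= _]ger0_norm ?subr_ge0 ?Phi_incr//.
  rewrite [X in _ * X]ger0_norm ?subr_ge0//.
  exact: growth_lipschitz.
rewrite distrC [X in _ * X]distrC.
rewrite [X in X <= _]ger0_norm ?subr_ge0 ?Phi_incr//.
rewrite [X in _ * X]ger0_norm ?subr_ge0//.
exact: growth_lipschitz.
Unshelve. all: by end_near. Qed.

Section nontrivial.
Context (z : R) (z0 : 0 <= z) (Phiz : 0 < Phi z).

Let zp : 0 < z.
Proof.
rewrite lt_neqAle z0 andbT; apply/eqP => zE.
by move: Phiz; rewrite -zE Phi0 ltxx.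
Qed.

Let Phi_gt0 x : 0 < x -> 0 < Phi x.
Proof.
move=> x0; have [xz|/ltW zx] := leP x z; last first.
  exact: lt_le_trans Phiz (Phi_incr _ zx).
rewrite -(divfK (lt0r_neq0 zp) x).
apply: lt_le_trans (growth_scale_ge _ z0).
  by rewrite mulr_gt0// exprn_gt0// divr_gt0.
by rewrite divr_ge0 ?(ltW zp) ?(ltW x0)//= ler_pdivrMr// mul1r.
Qed.

Lemma growth_inj : {in (`[0, +oo[%classic : set R) &, injective Phi}.
Proof.
have H x y : 0 <= x -> x < y -> Phi x < Phi y.
  move=> x0 xy; have [->|xN0] := eqVneq x 0; first by rewrite Phi0 Phi_gt0//; lra.
  have xp : 0 < x by rewrite lt_neqAle eq_sym xN0.
  have k1 : 1 <= y / x by rewrite ler_pdivlMr// mul1r ltW.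
  have := growth_expand k1 x0; rewrite divfK ?gt_eqF//; apply: lt_le_trans.
  by rewrite ltr_pMl ?Phi_gt0// ltr_pdivlMr// mul1r.
move=> x y; rewrite !inE/= !in_itv/= !andbT => x0 y0 xy.
have [/H|/H|//] := ltgtP x y.
  by move=> /(_ x0); rewrite xy ltxx.
by move=> /(_ y0); rewrite xy ltxx.
Qed.

(** The inverse [inverse_on_Rplus] is a partial inverse chosen by a choice
    operator: existence of a preimage of 1 comes from the intermediate value
    theorem, and injectivity identifies the chosen one. *)
Lemma growth_inverse1 : 0 < inverse_on_Rplus Phi 1 /\
  Phi (inverse_on_Rplus Phi 1) = 1.
Proof.
have [r [r0 Phir]] : exists r, 0 <= r /\ Phi r = 1.
  pose k := (Phi z)^-1 + 1.
  have k1 : 1 <= k by rewrite /k lerDr invr_ge0 ltW.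
  have kz0 : 0 <= k * z by rewrite mulr_ge0//; lra.
  have k2 : 1 <= Phi (k * z).
    apply: le_trans (growth_expand k1 z0).
    by rewrite /k mulrDl mulVf ?gt_eqF// mul1r lerDl ltW.
  have [] := @IVT R (fun x => Phi `|x|) 0 (k * z) 1 kz0.
  - by apply: continuous_subspaceT; exact: growth_continuous.
  - have p0 := Phi_ge0 kz0.
    by rewrite normr0 Phi0 (ger0_norm kz0) (min_l p0) (max_r p0) ler01 k2.
  - move=> c; rewrite in_itv/= => /andP[c0 _] <-.
    by exists c; rewrite ger0_norm.
have rE : inverse_on_Rplus Phi 1 = r.
  rewrite -Phir /inverse_on_Rplus pinvKV//; first exact: growth_inj.
  by rewrite inE/= in_itv/= r0.
rewrite rE; split => //; rewrite lt_neqAle r0 andbT.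
by apply/eqP => re; move: Phir; rewrite -re Phi0; lra.
Qed.

End nontrivial.
End growth.

(** * Derivatives of pointwise operations *)

Section pointwise_derivatives.
Context {R : realType}.
Implicit Types (f g : R -> R) (a b c k x : R).

Lemma is_derive_cstf c x : is_derive x 1 (fun=> c) 0.
Proof. exact: is_derive_cst. Qed.

Lemma is_derive_addf f g a b x : is_derive x 1 f a -> is_derive x 1 g b ->
  is_derive x 1 (fun s => f s + g s) (a + b).
Proof. exact: is_deriveD. Qed.

Lemma is_derive_oppf f a x : is_derive x 1 f a ->
  is_derive x 1 (fun s => - f s) (- a).
Proof. exact: is_deriveN. Qed.

Lemma is_derive_scalef f a k x : is_derive x 1 f a ->
  is_derive x 1 (fun s => k * f s) (k * a).
Proof. exact: is_deriveZ. Qed.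

Lemma is_derive_shiftf f a d x : is_derive (x + d) 1 f a ->
  is_derive x 1 (fun s => f (s + d)) a.
Proof.
move=> fa; have h : is_derive x 1 (fun s => s + d) (1 + 0 : R).
  by apply: is_derive_addf (is_derive_id _ _) (is_derive_cstf _ _).
have := @is_derive1_comp R f (fun s => s + d) x a _ fa h.
by rewrite addr0 mulr1.
Qed.

Lemma is_derive_reflect f a x : is_derive (- x) 1 f a ->
  is_derive x 1 (fun s => f (- s)) (- a).
Proof.
move=> fa; have := @is_derive1_comp R f -%R x a _ fa (is_deriveNid x 1).
by rewrite mulrN1.
Qed.

Lemma is_derive_expRf f a x : is_derive x 1 f a ->
  is_derive x 1 (fun s => expR (f s)) (expR (f x) * a).
Proof.
by move=> fa; have := @is_derive1_comp R expR f x _ a (is_derive_expR (f x)) fa.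
Qed.

Lemma is_derive_lnf f a x : 0 < f x -> is_derive x 1 f a ->
  is_derive x 1 (fun s => ln (f s)) ((f x)^-1 * a).
Proof.
move=> f0 fa.
by have := @is_derive1_comp R (@ln R) f x _ a (is_derive1_ln f0) fa.
Qed.

Lemma is_derive_continuous f a x : is_derive x 1 f a -> {for x, continuous f}.
Proof.
move=> fa; apply/differentiable_continuous/derivable1_diffP.
exact: (@ex_derive _ _ _ _ _ _ _ fa).
Qed.

End pointwise_derivatives.

(** * Measures with a continuous density *)

Section density.
Context {R : realType} (mu : probability (measurableTypeR R) R) (p : R -> R).
Local Notation leb := (@lebesgue_measure R).
Hypothesis p_gt0 : forall x, 0 < p x.
Hypothesis p_cont : continuous p.
Hypothesis muE : forall A : set (measurableTypeR R), measurable A ->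
  mu A = (\int[leb]_(x in A) (p x)%:E)%E.

Lemma measurable_density : measurable_fun [set: measurableTypeR R] p.
Proof. exact: continuous_measurable_fun. Qed.

Import HBNNSimple.

Let integral_density_nnsfun (f : {nnsfun measurableTypeR R >-> R}) :
  (\int[mu]_x (f x)%:E = \int[leb]_x ((f x)%:E * (p x)%:E))%E.
Proof.
have mp := measurable_density.
transitivity (\sum_(k \in range f)
    \int[leb]_x (k%:E * (\1_(f @^-1` [set k]) x)%:E * (p x)%:E))%E; last first.
  rewrite -ge0_integral_fsum//; last 2 first.
  - move=> k; apply: emeasurable_funM; last exact/measurable_EFinP.
    by apply: measurable_funeM; exact/measurable_EFinP.
  - move=> k x _; rewrite mule_ge0 ?lee_fin ?(ltW (p_gt0 _))//.
    exact: nnfun_muleindic_ge0.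
  apply: eq_integral => x _.
  rewrite -ge0_mule_fsuml; last by move=> k; exact: nnfun_muleindic_ge0.
  by rewrite [in RHS](fimfunE f) -fsumEFin.
under eq_integral do rewrite fimfunE -fsumEFin//.
rewrite ge0_integral_fsum//; last 2 first.
- by move=> k; exact/measurable_EFinP/measurable_funM.
- by move=> k x _; rewrite nnfun_muleindic_ge0.
apply: eq_fsbigr => k _.
have mk : measurable (f @^-1` [set k]) by exact: measurable_sfunP.
have [k0|k0] := ltP k 0.
  rewrite preimage_nnfun0//.
  by rewrite !integral0_eq// => x _; rewrite indic0 ?mulr0 ?mule0 ?mul0e.
under eq_integral do rewrite EFinM.
rewrite ge0_integralZl//; last exact/measurable_EFinP.
under [RHS]eq_integral do rewrite -muleA.
rewrite [RHS]ge0_integralZl//; last 2 first.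
- by apply: emeasurable_funM; exact/measurable_EFinP.
- by move=> x _; rewrite mule_ge0 ?lee_fin ?(ltW (p_gt0 _)).
congr (_ * _)%E; rewrite integral_indic// setIT. apply: etrans (muE mk) _.
rewrite [in LHS]integral_mkcond; apply: eq_integral => x _.
rewrite patchE indicE; case: ifPn => xk; first by rewrite mul1e.
by rewrite mul0e.
Qed.

(** The formula holds for indicators by definition of the density, hence for
    simple functions, and passes to monotone limits. *)
Lemma ge0_integral_density (f : measurableTypeR R -> \bar R) :
  measurable_fun [set: _] f -> (forall x, (0 <= f x)%E) ->
  (\int[mu]_x f x = \int[leb]_x (f x * (p x)%:E))%E.
Proof.
move=> mf f0; have mp := measurable_density.
pose f_ := nnsfun_approx measurableT mf.
transitivity (limn (fun n => \int[mu]_x (f_ n x)%:E))%E.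
  rewrite -monotone_convergence//=.
  - apply: eq_integral => x _; apply/esym/cvg_lim => //=.
    exact: cvg_nnsfun_approx.
  - by move=> n; exact/measurable_EFinP/measurable_funTS.
  - by move=> n ? _; rewrite lee_fin.
  - by move=> ? _ ? ? mn; rewrite lee_fin; exact/lefP/nd_nnsfun_approx.
under eq_fun do rewrite integral_density_nnsfun.
rewrite -monotone_convergence//=.
- apply: eq_integral => x _; apply/cvg_lim => //=.
  apply: cvgeZr => //; exact: cvg_nnsfun_approx.
- by move=> n; apply: emeasurable_funM; exact/measurable_EFinP.
- by move=> n x _; rewrite mule_ge0 ?lee_fin ?(ltW (p_gt0 _)).
- move=> x _ m n mn; rewrite lee_wpmul2r ?lee_fin ?(ltW (p_gt0 _))//.
  exact/lefP/nd_nnsfun_approx.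
Qed.

End density.

(** Locked, so that comparing two of its values never unfolds the integrals. *)
HB.lock Definition primitive {R : realType} (f : R -> R) (x : R) : R :=
  \int[@lebesgue_measure R]_(t in `]-oo, x]) f t.

Section primitive.
Context {R : realType}.
Local Notation leb := (@lebesgue_measure R).
Implicit Types (f df : R -> R) (a b x y : R).

Let primitiveE f : primitive f = fun x => \int[leb]_(t in `]-oo, x]) f t.
Proof. by apply/funext => x; rewrite primitive.unlock. Qed.

Lemma primitive_is_derive f x : leb.-integrable [set: R] (EFin \o f) ->
  continuous f -> is_derive x 1 (primitive f) (f x).
Proof.
move=> fi cf; rewrite primitiveE.
have xx1 : x < x + 1 by lra.
have fi' : leb.-integrable `]-oo, x + 1] (EFin \o f).
  exact: integrableS fi.
have [d1 d2] := @continuous_FTC1 R f -oo%O x (x + 1) xx1 fi' (ltNyr _) (cf x).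
by apply: (@DeriveDef _ _ _ _ _ _ _ d1); rewrite -derive1E.
Qed.

Lemma primitiveB f a b : leb.-integrable [set: R] (EFin \o f) -> a <= b ->
  primitive f b - primitive f a = \int[leb]_(t in `]a, b]) f t.
Proof.
move=> fi ab; rewrite primitiveE.
by apply: Rintegral_itvB => //; apply: integrableS fi.
Qed.

Lemma primitive_le f a b : leb.-integrable [set: R] (EFin \o f) ->
  (forall x, 0 <= f x) -> a <= b -> primitive f a <= primitive f b.
Proof.
move=> fi f0 ab; rewrite -subr_ge0 primitiveB//.
by apply: Rintegral_ge0 => x _.
Qed.

Lemma primitive_window_le f (C : R) :
  leb.-integrable [set: R] (EFin \o f) -> (forall x, 0 <= f x) ->
  (forall N : nat, primitive f N%:R - primitive f (- N%:R) <= C) ->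
  (\int[leb]_x (f x)%:E <= C%:E)%E.
Proof.
move=> fi f0 bnd.
have mf : measurable_fun [set: R] (EFin \o f) by case/integrableP : fi.
pose D (n : nat) : set R := `]- n%:R, n%:R]%classic.
have Dcov : \bigcup_n D n = [set: R].
  rewrite -subTset => x _; exists (Num.bound x) => //.
  have := unstable.ltr_norm_bound x; rewrite ltr_norml => /andP[h1 h2].
  by rewrite /D/= in_itv/= h1 ltW.
have Dcvg : (\int[leb]_(x in D n) (f x)%:E)%E @[n --> \oo] -->
    (\int[leb]_x (f x)%:E)%E.
  rewrite -Dcov; apply: ge0_nondecreasing_set_cvg_integral.
  - move=> m n mn; apply/subsetPset; apply: subset_itv.
      by rewrite bnd_simp lerN2 ler_nat.
    by rewrite bnd_simp ler_nat.
  - by move=> n; exact: measurable_itv.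
  - by move=> n; exact: measurable_funTS.
  - by move=> n x _; rewrite lee_fin.
rewrite -(cvg_lim _ Dcvg)//; apply: lime_le.
  by apply/cvg_ex; eexists; exact: Dcvg.
near=> n; have := bnd n; rewrite primitiveB//; last first.
  by rewrite (@le_trans _ _ 0)// ?oppr_le0.
rewrite -lee_fin; apply: le_trans; rewrite /Rintegral fineK//.
by apply: integrable_fin_num => //; apply: integrableS fi.
Unshelve. all: by end_near. Qed.

End primitive.

Lemma is_derive_ge0_le {R : realType} (f df : R -> R) (a b : R) : a <= b ->
  (forall x : R, is_derive x 1 f (df x)) -> (forall x, a <= x -> 0 <= df x) ->
  f a <= f b.
Proof.
rewrite le_eqVlt => /predU1P[->//|ab] fdf df0.
have cf : {within `[a, b], continuous f}.
  apply: continuous_subspaceT => x; apply: differentiable_continuous.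
  exact/derivable1_diffP/(@ex_derive _ _ _ _ _ _ _ (fdf x)).
have [c] := @MVT R f df a b ab (fun x _ => fdf x) cf.
rewrite in_itv/= => /andP[ac _] fE; rewrite -subr_ge0 fE mulr_ge0 ?subr_ge0//.
  exact/df0/ltW.
exact: ltW.
Qed.

Section distribution_function.
Context {R : realType} (mu : probability (measurableTypeR R) R) (p : R -> R).
Local Notation leb := (@lebesgue_measure R).
Local Notation P := (primitive p).
Implicit Types x a b e : R.
Hypothesis p_gt0 : forall x, 0 < p x.
Hypothesis p_cont : continuous p.
Hypothesis muE : forall A : set (measurableTypeR R), measurable A ->
  mu A = (\int[leb]_(x in A) (p x)%:E)%E.

Lemma density_total : (\int[leb]_x (p x)%:E = 1)%E.
Proof. by apply: etrans (esym (muE measurableT)) _; exact: probability_setT. Qed.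

Lemma density_integrable : leb.-integrable [set: R] (EFin \o p).
Proof.
apply/integrableP; split.
  by apply/measurable_EFinP; exact: continuous_measurable_fun.
under eq_integral do rewrite /= (ger0_norm (ltW (p_gt0 _))).
by rewrite density_total ltry.
Qed.

Lemma distribution_is_derive x : is_derive x 1 P (p x).
Proof. exact: primitive_is_derive density_integrable p_cont. Qed.

Lemma distribution_ge0_le1 x : 0 <= P x <= 1.
Proof.
apply/andP; split.
  by rewrite primitive.unlock; apply: Rintegral_ge0 => y _; exact: ltW.
rewrite -lee_fin primitive.unlock /Rintegral fineK; last first.
  apply: integrable_fin_num => //; apply: integrableS density_integrable => //.
by rewrite -muE//; exact: probability_le1.
Qed.

Lemma distribution_ltW a b : a < b -> P a < P b.
Proof.
move=> ab.
have cf : {within `[a, b], continuous P}.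
  apply: continuous_subspaceT => x; apply: differentiable_continuous.
  exact/derivable1_diffP/(@ex_derive _ _ _ _ _ _ _ (distribution_is_derive x)).
have [c _] := @MVT R P p a b ab (fun x _ => distribution_is_derive x) cf.
by move=> fE; rewrite -subr_gt0 fE mulr_gt0 ?subr_gt0.
Qed.

Lemma distribution_gt0 x : 0 < P x.
Proof.
have /distribution_ltW : x - 1 < x by lra.
by apply: le_lt_trans; case/andP: (distribution_ge0_le1 (x - 1)).
Qed.

Lemma distribution_lt1 x : P x < 1.
Proof.
have /distribution_ltW : x < x + 1 by lra.
by move/lt_le_trans; apply; case/andP: (distribution_ge0_le1 (x + 1)).
Qed.

(** Otherwise all symmetric windows would have mass at most [1 - e], and so
    would the whole line. *)
Lemma distribution_tails e : 0 < e ->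
  exists n : nat, 1 - P n%:R <= e /\ P (- n%:R) <= e.
Proof.
move=> e0; suff [n hn] : exists n : nat, 1 - e < P n%:R - P (- n%:R).
  exists n; have /andP[h1 _] := distribution_ge0_le1 (- n%:R).
  by have /andP[_ h2] := distribution_ge0_le1 n%:R; split; lra.
apply: contrapT => /forallNP h.
have : ((1 : R)%:E <= (1 - e)%:E)%E.
  rewrite -density_total; apply: primitive_window_le.
  - exact: density_integrable.
  - by move=> x; exact: ltW.
  - by move=> n; have /negP := h n; rewrite -leNgt.
by rewrite lee_fin; lra.
Qed.

End distribution_function.

(** * Tails of the one-dimensional measure *)

Section exponential_tail.
Context {R : realType} (mu : probability (measurableTypeR R) R).
Context (Phi : R -> R) (p : R -> R) (p0 : R).
Local Notation leb := (@lebesgue_measure R).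
Local Notation P := (primitive p).
Implicit Types x y d e s : R.
Hypothesis Phi_incr : forall x y : R, 0 <= x -> x <= y -> Phi x <= Phi y.
Hypothesis Phi_superadd : forall x y : R, 0 <= x -> 0 <= y ->
  Phi x + Phi y <= Phi (x + y).
Hypothesis p0_gt0 : 0 < p0.
Hypothesis pE : forall x, p x = p0 * expR (- Phi `|x|).
Hypothesis p_cont : continuous p.
Hypothesis muE : forall A : set (measurableTypeR R), measurable A ->
  mu A = (\int[leb]_(x in A) (p x)%:E)%E.

Let p_gt0 x : 0 < p x.
Proof. by rewrite pE mulr_gt0 ?expR_gt0. Qed.

Let dP x : is_derive x 1 P (p x).
Proof. exact: distribution_is_derive p_gt0 p_cont muE x. Qed.

Let P_lt1 x : P x < 1.
Proof. exact: distribution_lt1 p_gt0 p_cont muE x. Qed.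

Let P_le x y : x <= y -> P x <= P y.
Proof.
rewrite le_eqVlt => /predU1P[->//|xy].
exact/ltW/(distribution_ltW p_gt0 p_cont muE).
Qed.

(** The sum of the two sides has derivative zero because the density is even,
    and its constant value is read off far away from the origin. *)
Lemma distribution_symmetric x : P (- x) = 1 - P x.
Proof.
have dg s : is_derive s 1 (fun s => P s + P (- s)) 0.
  apply: (is_derive_eq (is_derive_addf (dP s) (is_derive_reflect (dP (- s))))).
  by rewrite [p (- s)]pE normrN -pE subrr.
have gcst a b : a <= b -> P a + P (- a) = P b + P (- b).
  move=> ab; apply/eqP; rewrite eq_le.
  rewrite (@is_derive_ge0_le _ (fun s => P s + P (- s)) (fun=> 0))//=.
  rewrite -lerN2; apply: (@is_derive_ge0_le _
    (fun s => - (P s + P (- s))) (fun=> - 0) _ _ ab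
    (fun s => is_derive_oppf (dg s))) => s _.
  by rewrite oppr0.
suff : P x + P (- x) = 1 by lra.
have {}gcst n : P x + P (- x) = P n + P (- n).
  by have [/gcst|/ltW/gcst] := leP x n.
have bnd e : 0 < e -> `|P x + P (- x) - 1| <= e.
  move=> /(distribution_tails p_gt0 p_cont muE)[n [h1 h2]].
  have /andP[h3 _] := distribution_ge0_le1 p_gt0 p_cont muE (- n%:R).
  have := P_lt1 n%:R; rewrite (gcst n%:R) ler_norml => h4; apply/andP; split; lra.
apply/eqP; rewrite -subr_eq0 -normr_le0; apply/ler_addgt0Pr => e /bnd.
by rewrite add0r.
Qed.

(** The Radon-Nikodym factor of a translation by [d] is at most [exp (- Phi d)]
    on the positive half-line, by superadditivity of [Phi]; integrating it is
    replaced by comparing derivatives of two functions that vanish at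
    infinity. *)
Lemma tail_shrink x d : 0 <= x -> 0 <= d ->
  1 - P (x + d) <= expR (- Phi d) * (1 - P x).
Proof.
move=> x0 d0; set k := expR (- Phi d).
have k0 : 0 <= k by exact: expR_ge0.
pose g s := - P (s + d) + k * P s.
have dg s : is_derive s 1 g (- p (s + d) + k * p s).
  apply: is_derive_addf; last exact: is_derive_scalef.
  exact: is_derive_oppf (is_derive_shiftf (dP _)).
have g'0 s : x <= s -> 0 <= - p (s + d) + k * p s.
  move=> xs; have s0 : 0 <= s by lra.
  rewrite addrC subr_ge0 !pE !ger0_norm ?addr_ge0// mulrCA ler_pM2l//.
  by rewrite -expRD ler_expR -opprD lerN2 addrC Phi_superadd.
suff : g x + (1 - k) <= 0 by rewrite /g; lra.
apply/ler_addgt0Pr => e e0; rewrite add0r.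
have [n [hn _]] := distribution_tails p_gt0 p_cont muE e0.
have gtail s : n%:R <= s -> g s + (1 - k) <= e.
  move=> ns; have h1 : P n%:R <= P (s + d) by apply: P_le; lra.
  have : 0 <= k * (1 - P s) by rewrite mulr_ge0// subr_ge0 ltW.
  by rewrite /g; lra.
have [nx|/ltW nx] := leP x n%:R; last exact: gtail.
apply: le_trans (gtail n%:R _) => //; rewrite lerD2r.
exact: is_derive_ge0_le nx dg g'0.
Qed.

Let P_ge0 x : 0 <= P x.
Proof. by case/andP: (distribution_ge0_le1 p_gt0 p_cont muE x). Qed.

(** Translating the whole half-line by [x] bounds the tail by the density: the
    hazard rate is at least [p0]. *)
Lemma tail_le_density x : 0 <= x -> p0 * (1 - P x) <= p x.
Proof.
move=> x0; rewrite pE ger0_norm// ler_pM2l//.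
have := tail_shrink (lexx 0) x0; rewrite add0r => /le_trans; apply.
by rewrite ger_pMr ?expR_gt0// gerBl.
Qed.

(** The second bound is the differential form of the hazard rate bound: the
    function [s |-> - ln (1 - P s) - p0 * s] is nondecreasing. *)
Lemma ln_tail_drop x y : 0 <= x -> x <= y ->
  Phi (y - x) <= ln (1 - P x) - ln (1 - P y) /\
  p0 * (y - x) <= ln (1 - P x) - ln (1 - P y).
Proof.
move=> x0 xy; have Q0 s : 0 < 1 - P s by rewrite subr_gt0.
split.
  have yx0 : 0 <= y - x by rewrite subr_ge0.
  have := tail_shrink x0 yx0; rewrite subrKC => h.
  have : ln (1 - P y) <= ln (expR (- Phi (y - x)) * (1 - P x)).
    by rewrite ler_ln ?posrE ?mulr_gt0 ?expR_gt0.
  by rewrite lnM ?posrE ?expR_gt0// expRK; lra.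
pose g s := - ln (1 - P s) - p0 * s.
suff : g x <= g y by rewrite /g; lra.
apply: (@is_derive_ge0_le _ g (fun s => - ((1 - P s)^-1 * (0 - p s)) - p0 * 1)
  _ _ xy) => [s|s xs].
  exact: is_derive_addf
    (is_derive_oppf (@is_derive_lnf R (fun s => 1 - P s) _ s (Q0 s)
      (is_derive_addf (is_derive_cstf 1 s) (is_derive_oppf (dP s)))))
    (is_derive_oppf (@is_derive_scalef R id 1 p0 s (is_derive_id s 1))).
rewrite sub0r mulrN opprK mulr1 subr_ge0 mulrC ler_pdivlMr//.
by apply: tail_le_density; lra.
Qed.

(** The logarithms of the two tails are the coordinates in which the measure
    looks exponential; far from the origin only one of them varies
    appreciably. *)
Definition log_gap x y : R :=
  Num.max `|ln (P x) - ln (P y)| `|ln (1 - P x) - ln (1 - P y)|.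

Lemma log_gapC x y : log_gap x y = log_gap y x.
Proof. by rewrite /log_gap distrC [X in Num.max _ X]distrC. Qed.

Lemma log_gapN x y : log_gap (- x) (- y) = log_gap x y.
Proof. by rewrite /log_gap !distribution_symmetric !subKr maxC. Qed.

(** After a reflection the right end [y] is the farther one from the origin,
    so that at least half of the segment lies on the positive side, where the
    right tail drops. *)
Lemma log_gap_ge x y :
  Phi (`|x - y| / 2) <= log_gap x y /\ p0 * (`|x - y| / 2) <= log_gap x y.
Proof.
wlog xy : x y / x <= y.
  move=> H; have [/H//|/ltW/H] := leP x y.
  by rewrite distrC log_gapC.
wlog Nxy : x y xy / - x <= y.
  move=> H; have [/(H _ _ xy)//|xyN] := leP (- x) y.
  have xy' : - y <= - x by lra.
  have Nxy' : - - y <= - x by lra.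
  by have := H _ _ xy' Nxy'; rewrite log_gapN log_gapC opprK addrC.
rewrite distrC ger0_norm ?subr_ge0//.
pose z := Num.max x 0.
have z0 : 0 <= z by rewrite /z le_max lexx orbT.
have xz : x <= z by rewrite /z le_max lexx.
have zy : z <= y by rewrite /z ge_max xy/=; lra.
have hz : (y - x) / 2 <= y - z.
  by rewrite /z; case: (leP x 0) => x0; lra.
have [h1 h2] := ln_tail_drop z0 zy.
have drop : ln (1 - P z) - ln (1 - P y) <= log_gap x y.
  rewrite /log_gap le_max; apply/orP; right; apply: le_trans (ler_norm _).
  rewrite lerD2r ler_ln ?posrE ?subr_gt0//.
  by rewrite lerD2l lerN2 P_le.
split; apply: le_trans drop.
  by apply: le_trans h1; apply: Phi_incr => //; lra.
by apply: le_trans h2; rewrite ler_pM2l.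
Qed.

End exponential_tail.

(** * A maximum principle for products of primitives *)

Section maximum_principle.
Context {R : realType}.

(** Only points on the left are compared, so the maximum may sit at the right
    end of an interval. *)
Lemma left_max_derive_ge0 (f : R -> R) (a c l : R) : is_derive c 1 f l ->
  a < c -> (forall x, a <= x <= c -> f x <= f c) -> 0 <= l.
Proof.
move=> [df <-] ac fmax.
have h1 := cvg_dnbhs_at_left df.
rewrite /derive -(cvg_lim _ h1)//; apply: limr_ge.
  by apply/cvg_ex; eexists; exact: h1.
near=> h.
have h0 : h < 0 by near: h; exact: nbhs_left_lt.
have hac : a - c < h by near: h; apply: nbhs_left_gt; lra.
rewrite /= [_%:A]mulr1 -[_ *: _]/(_ * _).
rewrite nmulr_rge0 ?invr_lt0// subr_le0; apply: fmax.
by apply/andP; split; lra.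
Unshelve. all: by end_near. Qed.

(** At a maximum point of the quotient [a x * b y / M x y ^+ 2] the two
    first-order conditions, multiplied together, compare [da * db] with
    [4 * M1 * M2] times the maximal value; the differential inequality
    therefore forbids a value above 1. This replaces the monotone transport
    of [da] to [db] in proofs of Prekopa-Leindler type. *)
Lemma product_primitives_le (a b da db : R -> R) (M M1 M2 : R -> R -> R)
    (N : R) :
  0 <= N ->
  (forall x : R, is_derive x 1 a (da x)) -> (forall x : R, is_derive x 1 b (db x)) ->
  (forall x y : R, is_derive x 1 (M ^~ y) (M1 x y)) ->
  (forall x y : R, is_derive y 1 (M x) (M2 x y)) ->
  continuous (fun z : R * R => M z.1 z.2) ->
  (forall x y, 0 < M x y) -> (forall x y, 0 < M1 x y) ->
  (forall x y, 0 < M2 x y) ->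
  a (- N) = 0 -> b (- N) = 0 ->
  (forall x, - N <= x -> 0 <= a x) -> (forall x, - N <= x -> 0 <= b x) ->
  (forall x y, da x * db y <= 4 * M1 x y * M2 x y) ->
  a N * b N <= M N N ^+ 2.
Proof.
move=> N0 dA dB dM1 dM2 cM M0 M10 M20 aN bN a0 b0 dab.
pose Q z := a z.1 * b z.2 / M z.1 z.2 ^+ 2.
pose I : set R := `[- N, N]%classic.
have NI : I N by rewrite /I/= in_itv/= lexx andbT; lra.
have cQ : continuous Q.
  move=> z; rewrite /Q.
  have ca : {for z, continuous (fun z : R * R => a z.1)}.
    by apply: continuous_comp; [exact: cvg_fst|exact: is_derive_continuous (dA _)].
  have cb : {for z, continuous (fun z : R * R => b z.2)}.
    by apply: continuous_comp; [exact: cvg_snd|exact: is_derive_continuous (dB _)].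
  apply: cvgM; first exact: cvgM.
  apply: cvgV; first by rewrite expf_neq0// gt_eqF.
  by apply: cvgM; exact: cM.
have [|||[x y]] := @compact_EVT_max (R * R)%type R Q (I `*` I).
- by exists (N, N).
- by apply: compact_setX; exact: segment_compact.
- exact: continuous_subspaceT.
rewrite inE => -[/= Ix Iy] Qmax.
have {}Qmax s t : I s -> I t -> Q (s, t) <= Q (x, y).
  by move=> Is It; apply: Qmax; rewrite inE.
set rho := Q (x, y) in Qmax.
have abM s t : a s * b t = Q (s, t) * M s t ^+ 2.
  by rewrite /Q divfK// expf_neq0// gt_eqF.
suff rho1 : rho <= 1.
  rewrite abM -[leRHS]mul1r ler_wpM2r ?sqr_ge0//.
  exact: le_trans (Qmax _ _ NI NI) rho1.
rewrite leNgt; apply/negP => rho1.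
have rho0 : 0 < rho by lra.
have ab0 : 0 < a x * b y by rewrite abM mulr_gt0// exprn_gt0.
move: Ix Iy; rewrite /I/= !in_itv/= => /andP[Nx xN] /andP[Ny yN].
have xN' : - N < x.
  rewrite lt_neqAle Nx andbT; apply/eqP => xE.
  by move: ab0; rewrite -xE aN mul0r ltxx.
have yN' : - N < y.
  rewrite lt_neqAle Ny andbT; apply/eqP => yE.
  by move: ab0; rewrite -yE bN mulr0 ltxx.
have ax : 0 <= a x by exact/a0/ltW.
have bY : 0 <= b y by exact/b0/ltW.
have dx : 0 <= b y * da x - rho * (2 * M x y * M1 x y).
  have dfx : is_derive x 1 (fun s => b y * a s - rho * M s y ^+ 2)
      (b y * da x - rho * (2 * M x y * M1 x y)).
    apply: (is_derive_eq (is_derive_addf (is_derive_scalef (b y) (dA x))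
      (is_derive_oppf (is_derive_scalef rho (is_deriveX 2 (dM1 x y)))))).
    by rewrite /= expr1 -[_ *: _]/(_ * _) -mulr_natl; ring.
  apply: (left_max_derive_ge0 dfx xN') => s /andP[Ns sx].
  have Is : I s by rewrite /I/= in_itv/=; apply/andP; split; lra.
  have Iy : I y by rewrite /I/= in_itv/=; apply/andP; split; lra.
  rewrite ![b y * _]mulrC !abM -/rho subrr -mulrBl.
  by rewrite mulr_le0_ge0 ?sqr_ge0// subr_le0 Qmax.
have dy : 0 <= a x * db y - rho * (2 * M x y * M2 x y).
  have dfy : is_derive y 1 (fun s => a x * b s - rho * M x s ^+ 2)
      (a x * db y - rho * (2 * M x y * M2 x y)).
    apply: (is_derive_eq (is_derive_addf (is_derive_scalef (a x) (dB y))
      (is_derive_oppf (is_derive_scalef rho (is_deriveX 2 (dM2 x y)))))).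
    by rewrite /= expr1 -[_ *: _]/(_ * _) -mulr_natl; ring.
  apply: (left_max_derive_ge0 dfy yN') => s /andP[Ns sx].
  have Is : I s by rewrite /I/= in_itv/=; apply/andP; split; lra.
  have Ix : I x by rewrite /I/= in_itv/=; apply/andP; split; lra.
  rewrite !abM -/rho subrr -mulrBl.
  by rewrite mulr_le0_ge0 ?sqr_ge0// subr_le0 Qmax.
have M12 : 0 < 4 * M1 x y * M2 x y by rewrite !mulr_gt0.
have : (rho * (2 * M x y * M1 x y)) * (rho * (2 * M x y * M2 x y)) <=
    (b y * da x) * (a x * db y).
  by apply: ler_pM; [apply/ltW; do !apply: mulr_gt0 => //..|lra|lra].
rewrite (_ : _ * (a x * db y) = (a x * b y) * (da x * db y)); last by ring.
have -> : rho * (2 * M x y * M1 x y) * (rho * (2 * M x y * M2 x y)) =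
    (a x * b y) * (rho * (4 * M1 x y * M2 x y)) by rewrite abM -/rho; ring.
rewrite ler_pM2l// => /le_trans /(_ (dab x y)).
by rewrite ger_pMl// leNgt rho1.
Qed.

End maximum_principle.

(** * Shifted midpoints and their gain *)

Section power_means.
Context {R : realType}.
Implicit Types s t u a b : R.

(** The average of the two weighted geometric means with weights 3/4 and 1/4,
    in logarithmic coordinates. For the exponential distribution it is a
    midpoint that is shifted towards the origin, which is what lets the
    Prekopa-Leindler argument gain a factor although that distribution has no
    uniform convexity. *)
Definition pmean s t : R :=
  (expR (3 / 4 * s + 1 / 4 * t) + expR (1 / 4 * s + 3 / 4 * t)) / 2.

Definition dpmean s t : R :=
  (3 / 4 * expR (3 / 4 * s + 1 / 4 * t) +
   1 / 4 * expR (1 / 4 * s + 3 / 4 * t)) / 2.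

(** Up to a factor, the product of the two partial derivatives of [pmean], see
    [dpmean_gain]: it exceeds 1 when the arguments differ, and grows
    exponentially with their difference. *)
Definition gain u : R := (10 + 3 * (expR (u / 2) + expR (- (u / 2)))) / 16.

Lemma pmeanC s t : pmean s t = pmean t s.
Proof.
by rewrite /pmean [in LHS]addrC [_ + 1 / 4 * t]addrC [_ + 3 / 4 * t]addrC.
Qed.

Lemma pmean_gt0 s t : 0 < pmean s t.
Proof. by rewrite /pmean divr_gt0// addr_gt0// expR_gt0. Qed.

Lemma dpmean_gt0 s t : 0 < dpmean s t.
Proof. by rewrite /dpmean divr_gt0// addr_gt0// mulr_gt0// ?expR_gt0//; lra. Qed.

Lemma pmean_lt1 s t : s < 0 -> t < 0 -> pmean s t < 1.
Proof.
move=> s0 t0; have h1 : expR (3 / 4 * s + 1 / 4 * t) < 1 by rewrite expR_lt1; lra.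
have h2 : expR (1 / 4 * s + 3 / 4 * t) < 1 by rewrite expR_lt1; lra.
by rewrite /pmean; lra.
Qed.

Lemma is_derive_pmean (f : R -> R) (a t x : R) : is_derive x 1 f a ->
  is_derive x 1 (fun s => pmean (f s) t) (dpmean (f x) t * a).
Proof.
move=> fa; pose l c d := is_derive_expRf (is_derive_addf
  (is_derive_scalef c fa) (is_derive_cstf (d * t) x)).
have -> : (fun s => pmean (f s) t) = (fun s => 2^-1 *
    (expR (3 / 4 * f s + 1 / 4 * t) + expR (1 / 4 * f s + 3 / 4 * t))).
  by apply/funext => s; rewrite /pmean mulrC.
apply: (is_derive_eq (is_derive_scalef 2^-1
  (is_derive_addf (l (3 / 4) (1 / 4)) (l (1 / 4) (3 / 4))))).
by rewrite /dpmean !addr0; field.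
Qed.

Lemma continuous_pmean (T : topologicalType) (f g : T -> R) :
  continuous f -> continuous g -> continuous (fun z => pmean (f z) (g z)).
Proof.
move=> cf cg.
have h (c d : R) : continuous (fun z => expR (c * f z + d * g z)).
  move=> z; apply: continuous_comp; last exact: continuous_expR.
  by apply: cvgD; apply: cvgMr; [exact: cf|exact: cg].
by move=> z; apply: cvgMl; apply: cvgD; exact: h.
Qed.

Lemma dpmean_gain s t :
  dpmean s t * dpmean t s = gain (s - t) * expR (s + t) / 4.
Proof.
rewrite /dpmean /gain.
have e1 : expR (3 / 4 * t + 1 / 4 * s) = expR (1 / 4 * s + 3 / 4 * t).
  by rewrite addrC.
have e2 : expR (1 / 4 * t + 3 / 4 * s) = expR (3 / 4 * s + 1 / 4 * t).
  by rewrite addrC.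
rewrite e1 e2.
set E := expR (3 / 4 * s + _); set E' := expR (1 / 4 * s + _).
have p1 : expR ((s - t) / 2) * expR (s + t) = E ^+ 2.
  by rewrite -expRD expr2 -expRD; congr expR; field.
have p2 : expR (- ((s - t) / 2)) * expR (s + t) = E' ^+ 2.
  by rewrite -expRD expr2 -expRD; congr expR; field.
have p3 : expR (s + t) = E * E'.
  by rewrite -expRD; congr expR; field.
rewrite (_ : _ * expR (s + t) = (10 * expR (s + t) +
  3 * (expR ((s - t) / 2) * expR (s + t) +
       expR (- ((s - t) / 2)) * expR (s + t))) / 16); last by field.
by rewrite p1 p2 p3; field.
Qed.

Lemma gain_ge1 u : 1 <= gain u.
Proof.
have := expR_ge1Dx (u / 2); have := expR_ge1Dx (- (u / 2)); rewrite /gain; lra.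
Qed.

(** The convexity bound [expR (w * v) <= 1 + w * (expR v - 1)], used with the
    weight [w = 3 / 64 * (1 - expR (- v))] for which the right-hand side is
    exactly [(3 + gain u) / 4]. *)
Lemma gain_ge_expR u (v := `|u| / 2) :
  expR (3 / 64 * (v ^+ 2 / (1 + v))) <= (3 + gain u) / 4.
Proof.
have v0 : 0 <= v by rewrite divr_ge0.
have gE : (3 + gain u) / 4 = 1 + 3 / 64 * ((1 - expR (- v)) * (expR v - 1)).
  rewrite mulrBr mulr1 mulrBl -expRD addNr expR0 mul1r /gain /v.
  by case: (ger0P u) => _; rewrite ?mulNr ?opprK; field.
rewrite gE; set w := 3 / 64 * (1 - expR (- v)).
have eN1 : expR (- v) <= 1 by rewrite expR_le1; lra.
have eN0 := expR_gt0 (- v).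
have w0 : 0 <= w by rewrite /w; lra.
have w1 : w <= 1 by rewrite /w; lra.
have wle : 3 / 64 * (v ^+ 2 / (1 + v)) <= w * v.
  rewrite /w -[leRHS]mulrA ler_pM2l; last by lra.
  rewrite expr2 -[leLHS]mulrA [leRHS]mulrC ler_wpM2l// ler_pdivrMr; last by lra.
  have h := expR_ge1Dx v.
  have : (1 + v) * expR (- v) <= 1.
    apply: (@le_trans _ _ (expR v * expR (- v))); first by rewrite ler_pM2r.
    by rewrite expRxMexpNx_1.
  by lra.
apply: (@le_trans _ _ (expR (w * v))); first by rewrite ler_expR.
apply: (@le_trans _ _ (1 + w * (expR v - 1))); last by rewrite /w mulrA.
have -> : 1 + w * (expR v - 1) = w * expR v + (1 - w) * expR 0.
  by rewrite expR0; ring.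
have := convex_expR (Itv01 w0 w1) v 0.
by rewrite !convRE mulr0 addr0.
Qed.

Lemma dpmean_ln_gain a b : 0 < a -> 0 < b ->
  dpmean (ln a) (ln b) / a * (dpmean (ln b) (ln a) / b) =
  gain (ln a - ln b) / 4.
Proof.
move=> a0 b0; rewrite mulrACA dpmean_gain expRD !lnK ?posrE//.
by move: (gain _) => g; field; rewrite !gt_eqF.
Qed.

(** Expanding the product, the two pure products are a quarter of the gains; the
    two mixed ones have product at least 1/16, hence sum at least 1/2. *)
Lemma gain_sum_le a b a' b' : 0 < a -> 0 < b -> 0 < a' -> 0 < b' ->
  (gain (ln a - ln b) + gain (ln a' - ln b') + 2) / 4 <=
  (dpmean (ln a) (ln b) / a + dpmean (ln a') (ln b') / a') *
  (dpmean (ln b) (ln a) / b + dpmean (ln b') (ln a') / b').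
Proof.
move=> a0 b0 a'0 b'0.
have := dpmean_ln_gain a0 b0; have := dpmean_ln_gain a'0 b'0.
have := divr_gt0 (dpmean_gt0 (ln a) (ln b)) a0.
have := divr_gt0 (dpmean_gt0 (ln b) (ln a)) b0.
have := divr_gt0 (dpmean_gt0 (ln a') (ln b')) a'0.
have := divr_gt0 (dpmean_gt0 (ln b') (ln a')) b'0.
have := gain_ge1 (ln a - ln b); have := gain_ge1 (ln a' - ln b').
move: (gain _) (gain _) (_ / a) (_ / b) (_ / a') (_ / b') => g' g X Y X' Y'.
move=> g1 g1' Y'0 X'0 Y0 X0 XY' XY.
have cross : 1 / 2 <= X * Y' + X' * Y.
  have h : 1 / 16 <= (X * Y') * (X' * Y).
    rewrite (_ : _ * (X' * Y) = (X * Y) * (X' * Y')); last by ring.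
    rewrite XY XY'.
    have : 1 * 1 <= g' * g by apply: ler_pM.
    by lra.
  have s0 : 0 <= X * Y' + X' * Y by rewrite addr_ge0// mulr_ge0// ltW.
  have h2 : (1 / 2) ^+ 2 <= (X * Y' + X' * Y) ^+ 2.
    by have := sqr_ge0 (X * Y' - X' * Y); lra.
  have half0 : 0 <= 1 / 2 :> R by lra.
  by rewrite -ler_sqr ?nnegrE.
have -> : (X + X') * (Y + Y') = X * Y + X' * Y' + (X * Y' + X' * Y) by ring.
by rewrite XY XY'; lra.
Qed.

End power_means.

(** * The two-function inequality on the line *)

Section two_function_inequality.
Context {R : realType} (mu : probability (measurableTypeR R) R) (p : R -> R).
Local Notation leb := (@lebesgue_measure R).
Local Notation P := (primitive p).
Implicit Types x y e s : R.
Hypothesis p_gt0 : forall x, 0 < p x.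
Hypothesis p_cont : continuous p.
Hypothesis muE : forall A : set (measurableTypeR R), measurable A ->
  mu A = (\int[leb]_(x in A) (p x)%:E)%E.

(** A lower bound of four times the product of the partial derivatives of the
    mean [M] below, relative to the densities. *)
Definition gain_kernel x y : R :=
  (gain (ln (P x) - ln (P y)) + gain (ln (1 - P x) - ln (1 - P y)) + 2) / 4.

(** The mean of the distribution functions that plays the part of the midpoint
    in the Prekopa-Leindler inequality: one half of it sees the ratios of left
    tails, the other half those of right tails. *)
Let M x y : R :=
  2^-1 * (pmean (ln (P x)) (ln (P y)) +
    (1 + - pmean (ln (1 - P x)) (ln (1 - P y)))).

Let M1 x y : R := 2^-1 * (dpmean (ln (P x)) (ln (P y)) * ((P x)^-1 * p x) +
  (0 + - (dpmean (ln (1 - P x)) (ln (1 - P y)) *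
          ((1 - P x)^-1 * (0 + - p x))))).

Let P0 x : 0 < P x.
Proof. exact: distribution_gt0 p_gt0 p_cont muE x. Qed.

Let Q0 x : 0 < 1 - P x.
Proof. by rewrite subr_gt0; exact: distribution_lt1 p_gt0 p_cont muE x. Qed.

Let dP x : is_derive x 1 P (p x).
Proof. exact: distribution_is_derive p_gt0 p_cont muE x. Qed.

Let MC x y : M x y = M y x.
Proof. by rewrite /M pmeanC [pmean (ln (1 - P x)) _]pmeanC. Qed.

Let dlnP x : is_derive x 1 (fun s => ln (P s)) ((P x)^-1 * p x).
Proof. exact: is_derive_lnf (P0 x) (dP x). Qed.

Let dlnQ x :
  is_derive x 1 (fun s => ln (1 - P s)) ((1 - P x)^-1 * (0 + - p x)).
Proof.
exact: (@is_derive_lnf R (fun s => 1 - P s) _ x (Q0 x)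
  (is_derive_addf (is_derive_cstf 1 x) (is_derive_oppf (dP x)))).
Qed.

Let dM x y : is_derive x 1 (M ^~ y) (M1 x y).
Proof.
exact: (is_derive_scalef 2^-1 (is_derive_addf
  (is_derive_pmean (ln (P y)) (dlnP x))
  (is_derive_addf (is_derive_cstf 1 x)
    (is_derive_oppf (is_derive_pmean (ln (1 - P y)) (dlnQ x)))))).
Qed.

Let lnP0 x : ln (P x) < 0.
Proof. by rewrite ln_lt0// P0 -subr_gt0 Q0. Qed.

Let lnQ0 x : ln (1 - P x) < 0.
Proof. by rewrite ln_lt0// Q0 gtrDl oppr_lt0 P0. Qed.

Let M_gt0 x y : 0 < M x y.
Proof.
have := pmean_gt0 (ln (P x)) (ln (P y)).
have := pmean_lt1 (lnQ0 x) (lnQ0 y).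
by rewrite /M => h1 h2; rewrite mulr_gt0//; lra.
Qed.

Let M_le1 x y : M x y <= 1.
Proof.
have := pmean_gt0 (ln (1 - P x)) (ln (1 - P y)).
have := pmean_lt1 (lnP0 x) (lnP0 y).
by rewrite /M => h1 h2; rewrite mulrC ler_pdivrMr//; lra.
Qed.

Let M1E x y : M1 x y = p x / 2 *
  (dpmean (ln (P x)) (ln (P y)) / P x +
   dpmean (ln (1 - P x)) (ln (1 - P y)) / (1 - P x)).
Proof. by rewrite /M1; ring. Qed.

Let M1_gt0 x y : 0 < M1 x y.
Proof.
rewrite M1E mulr_gt0 ?divr_gt0 ?p_gt0// addr_gt0// divr_gt0 ?dpmean_gt0//.
Qed.

Let continuous_M : continuous (fun z : R * R => M z.1 z.2).
Proof.
have h (f : R -> R) (df : R -> R) : (forall s, is_derive s 1 f (df s)) ->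
    continuous (fun z : R * R => f z.1) /\ continuous (fun z : R * R => f z.2).
  move=> fdf; split => z; apply: continuous_comp.
  - exact: cvg_fst.
  - exact: is_derive_continuous (fdf _).
  - exact: cvg_snd.
  - exact: is_derive_continuous (fdf _).
have [l1 l2] := h _ _ dlnP; have [r1 r2] := h _ _ dlnQ.
move=> z; apply: cvgMr; apply: cvgD; first exact: continuous_pmean l1 l2 z.
apply: cvgD; first exact: cvg_cst.
by apply: cvgN; exact: continuous_pmean r1 r2 z.
Qed.

Let kernel_le x y : p x * p y * gain_kernel x y <= 4 * M1 x y * M1 y x.
Proof.
rewrite !M1E /gain_kernel.
have := gain_sum_le (P0 x) (P0 y) (Q0 x) (Q0 y).
move: (_ / P x) (_ / P y) (_ / (1 - P x)) (_ / (1 - P y)) => X Y X' Y'.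
move: (_ / 4) (p_gt0 x) (p_gt0 y); move: (p x) (p y) => u v k u0 v0 h.
rewrite (_ : 4 * _ * _ = u * v * ((X + X') * (Y + Y'))); last by field.
by rewrite ler_pM2l ?mulr_gt0.
Qed.

Section two_functions.
Context (F G : R -> R).
Hypotheses (F_ge0 : forall x, 0 <= F x) (G_ge0 : forall x, 0 <= G x).
Hypotheses (F_cont : continuous F) (G_cont : continuous G).
Hypotheses (F_bnd : exists C, forall x, F x <= C).
Hypotheses (G_bnd : exists C, forall x, G x <= C).
Hypothesis FG : forall x y, F x * G y <= gain_kernel x y.

Let bounded_integrable (f : R -> R) : (forall x, 0 <= f x) -> continuous f ->
  (exists C, forall x, f x <= C) ->
  leb.-integrable [set: R] (EFin \o (fun x => f x * p x)).
Proof.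
move=> f0 cf [C fC].
have ip := density_integrable p_gt0 p_cont muE.
apply: (le_integrable measurableT _ _ (integrableZl measurableT C ip)).
- apply/measurable_EFinP; apply: measurable_funM;
    exact: continuous_measurable_fun.
- move=> x _ /=; rewrite lee_fin !ger0_norm.
  + by rewrite ler_wpM2r// ltW.
  + by rewrite mulr_ge0//; [exact: le_trans (f0 x) (fC x)|exact: ltW].
  + by rewrite mulr_ge0// ltW.
Qed.

Let integral_prod (f : R -> R) : (forall x, 0 <= f x) -> continuous f ->
  (\int[mu]_x (f x)%:E = \int[leb]_x (f x * p x)%:E)%E.
Proof.
move=> f0 cf; rewrite (ge0_integral_density p_gt0 p_cont muE)//.
by apply/measurable_EFinP; exact: continuous_measurable_fun.
Qed.

Let window (f : R -> R) (N : nat) :=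
  primitive (fun x => f x * p x) N%:R - primitive (fun x => f x * p x) (- N%:R).

Let window_le (f : R -> R) : (forall x, 0 <= f x) -> continuous f ->
  (exists C, forall x, f x <= C) -> {homo window f : m n / (m <= n)%N >-> m <= n}.
Proof.
move=> f0 cf fC m n mn; have fi := bounded_integrable f0 cf fC.
have fp x : 0 <= f x * p x by rewrite mulr_ge0// ltW.
by rewrite lerB// primitive_le// ?lerN2 ler_nat.
Qed.

(** The maximum principle on the square with vertices [(+-N, +-N)], for the
    primitives that vanish at [- N]. *)
Let window_prod N : window F N * window G N <= 1.
Proof.
have iF := bounded_integrable F_ge0 F_cont F_bnd.
have iG := bounded_integrable G_ge0 G_cont G_bnd.
have dprim (f : R -> R) : leb.-integrable [set: R] (EFin \o (fun x => f x * p x)) ->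
    continuous f -> forall x : R,
    is_derive x 1 (fun s => primitive (fun x => f x * p x) s -
      primitive (fun x => f x * p x) (- N%:R)) (f x * p x).
  move=> fi cf x.
  have cfp : continuous (fun x => f x * p x).
    by move=> z; apply: cvgM; [exact: cf|exact: p_cont].
  apply: (is_derive_eq (is_derive_addf (primitive_is_derive x fi cfp)
    (is_derive_cstf _ x))).
  by rewrite addr0.
have M_sqr : M N%:R N%:R ^+ 2 <= 1 by rewrite expr_le1// ltW.
apply: le_trans M_sqr.
have dM2 x y : is_derive y 1 (M x) (M1 y x).
  by rewrite (_ : M x = M ^~ x); [exact: dM|apply/funext => s; exact: MC].
pose a s := primitive (fun x => F x * p x) s -
  primitive (fun x => F x * p x) (- N%:R).
pose b s := primitive (fun x => G x * p x) s -
  primitive (fun x => G x * p x) (- N%:R).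
have a0 x : - N%:R <= x -> 0 <= a x.
  move=> Nx; rewrite /a subr_ge0 primitive_le// => z.
  by rewrite mulr_ge0// ltW.
have b0 x : - N%:R <= x -> 0 <= b x.
  move=> Nx; rewrite /b subr_ge0 primitive_le// => z.
  by rewrite mulr_ge0// ltW.
have dab x y : F x * p x * (G y * p y) <= 4 * M1 x y * M1 y x.
  apply: le_trans (kernel_le x y).
  by rewrite mulrACA mulrC ler_pM2l ?mulr_gt0.
have aN : a (- N%:R) = 0 by rewrite /a subrr.
have bN : b (- N%:R) = 0 by rewrite /b subrr.
exact: (@product_primitives_le R a b (fun x => F x * p x) (fun x => G x * p x)
  M M1 (fun x y => M1 y x) N%:R (ler0n R N) (dprim _ iF F_cont)
  (dprim _ iG G_cont) dM dM2 continuous_M M_gt0 M1_gt0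
  (fun x y => M1_gt0 y x) aN bN a0 b0 dab).
Qed.

(** Windows of different sizes are allowed for the two functions, so that the
    two limits can be taken one after the other. *)
Theorem two_function_inequality :
  (\int[mu]_x (F x)%:E * \int[mu]_x (G x)%:E <= 1)%E.
Proof.
have iF := bounded_integrable F_ge0 F_cont F_bnd.
have iG := bounded_integrable G_ge0 G_cont G_bnd.
have Fp x : 0 <= F x * p x by rewrite mulr_ge0// ltW.
have Gp x : 0 <= G x * p x by rewrite mulr_ge0// ltW.
rewrite !integral_prod//.
have fin (f : R -> R) : leb.-integrable [set: R] (EFin \o (fun x => f x * p x)) ->
    exists A, (\int[leb]_x (f x * p x)%:E)%E = A%:E.
  move=> /(integrable_fin_num measurableT) h; eexists; exact/esym/fineK.
have [A FA] := fin F iF; have [B GB] := fin G iG.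
rewrite FA GB -EFinM lee_fin.
have wAB m n : window F m * window G n <= 1.
  apply: le_trans (window_prod (maxn m n)).
  have w0 (f : R -> R) k : leb.-integrable [set: R] (EFin \o (fun x => f x * p x)) ->
      (forall x, 0 <= f x) -> 0 <= window f k.
    move=> fi f0; rewrite subr_ge0 primitive_le//.
      by move=> x; rewrite mulr_ge0// ltW.
    by rewrite (@le_trans _ _ 0)// ?oppr_le0.
  apply: ler_pM; rewrite ?w0//.
  - by apply: window_le => //; exact: leq_maxl.
  - by apply: window_le => //; exact: leq_maxr.
have AB n : A * window G n <= 1.
  have [w0|w0] := leP (window G n) 0.
    apply: (@le_trans _ _ 0) => //; rewrite mulr_ge0_le0// -lee_fin -FA.
    by apply: integral_ge0 => x _; rewrite lee_fin.
  rewrite -ler_pdivlMr// -lee_fin -FA; apply: primitive_window_le => // m.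
  by rewrite ler_pdivlMr//; exact: wAB.
have [A0|A0] := leP A 0.
  apply: (@le_trans _ _ 0) => //; rewrite mulr_le0_ge0// -lee_fin -GB.
  by apply: integral_ge0 => x _; rewrite lee_fin.
rewrite mulrC -ler_pdivlMr// -lee_fin -GB; apply: primitive_window_le => // m.
by rewrite ler_pdivlMr// mulrC; exact: AB.
Qed.

End two_functions.
End two_function_inequality.

(** * Tensorization *)

Section euclidean_distance_of_cons.
Context {R : realType} (n : nat).
Implicit Types (x y : R) (s t : n.-tuple R).

Lemma euclidean_dist_cons x y s t :
  euclidean_dist [tuple of x :: s] [tuple of y :: t] =
  Num.sqrt ((x - y) ^+ 2 + \sum_(i < n) (tnth s i - tnth t i) ^+ 2).
Proof.
rewrite /euclidean_dist big_ord_recl !tnth0; congr (Num.sqrt (_ + _)).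
by apply: eq_bigr => i _; rewrite !tnthS.
Qed.

Lemma euclidean_dist_head x y s :
  euclidean_dist [tuple of x :: s] [tuple of y :: s] = `|x - y|.
Proof.
rewrite euclidean_dist_cons big1 ?addr0 ?sqrtr_sqr// => i _.
by rewrite subrr expr0n.
Qed.

Lemma euclidean_dist_tail x s t :
  euclidean_dist [tuple of x :: s] [tuple of x :: t] = euclidean_dist s t.
Proof. by rewrite euclidean_dist_cons subrr expr0n/= add0r. Qed.

End euclidean_distance_of_cons.

Section tensorization.
Context {R : realType} (mu : probability (measurableTypeR R) R).
Context (K : R -> R -> R).
Hypothesis K_gt0 : forall x y, 0 < K x y.
Hypothesis two_fun : forall F G : R -> R,
  (forall x, 0 <= F x) -> (forall x, 0 <= G x) ->
  continuous F -> continuous G ->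
  (exists C, forall x, F x <= C) -> (exists C, forall x, G x <= C) ->
  (forall x y, F x * G y <= K x y) ->
  (\int[mu]_x (F x)%:E * \int[mu]_x (G x)%:E <= 1)%E.

(** The logarithmic Lipschitz bound survives integration over some of the
    coordinates, and makes the marginals continuous. *)
Definition tame n (F : n.-tuple (measurableTypeR R) -> R) :=
  [/\ measurable_fun [set: _] F, forall x, 0 <= F x,
      exists C, forall x, F x <= C &
      exists L, forall x y, F x <= expR (L * euclidean_dist x y) * F y].

Let P n := product_power mu n.

Lemma integral_product_powerS n (F : n.+1.-tuple (measurableTypeR R) -> \bar R) :
  measurable_fun [set: _] F -> (forall x, 0 <= F x)%E ->
  (\int[P n.+1]_x F x = \int[mu]_x \int[P n]_s F [tuple of x :: s])%E.
Proof.
move=> mF F0.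
have mFc : measurable_fun [set: _] (F \o @tuple_cons _ (measurableTypeR R) n).
  by apply: measurableT_comp => //; exact: measurable_tuple_cons.
transitivity (\int[mu \x P n]_z (F \o @tuple_cons _ _ n) z)%E.
  exact: ge0_integral_distribution.
by rewrite fubini_tonelli1// => z; exact: F0.
Qed.

Let bounded_integral n (F : n.-tuple (measurableTypeR R) -> R) C :
  measurable_fun [set: _] F -> (forall x, 0 <= F x) -> (forall x, F x <= C) ->
  (\int[P n]_x (F x)%:E <= C%:E)%E.
Proof.
move=> mF F0 FC.
apply: (@le_trans _ _ (\int[P n]_x (cst C%:E) x)%E).
  apply: ge0_le_integral => //.
  - by move=> x _; rewrite lee_fin.
  - exact/measurable_EFinP.
  - by move=> x _; rewrite lee_fin.
by rewrite integral_cst// [X in (_ * X)%E]probability_setT mule1.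
Qed.

Let head_int n (F : n.+1.-tuple (measurableTypeR R) -> R) x :=
  fine (\int[P n]_s (F [tuple of x :: s])%:E)%E.

Let measurable_slice n (F : n.+1.-tuple (measurableTypeR R) -> R) x :
  measurable_fun [set: _] F ->
  measurable_fun [set: n.-tuple (measurableTypeR R)] (fun s => F [tuple of x :: s]).
Proof.
move=> mF; apply: (measurableT_comp mF).
have := measurableT_comp (@measurable_tuple_cons _ (measurableTypeR R) n)
  (@pair1_measurable _ _ (measurableTypeR R) (n.-tuple (measurableTypeR R)) x).
exact.
Qed.

Let head_intE n (F : n.+1.-tuple (measurableTypeR R) -> R) x : tame F ->
  (\int[P n]_s (F [tuple of x :: s])%:E)%E = (head_int F x)%:E.
Proof.
move=> [mF F0 [C FC] _]; rewrite /head_int fineK// ge0_fin_numE; last first.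
  by apply: integral_ge0 => s _; rewrite lee_fin.
apply: (@le_lt_trans _ _ C%:E); last exact: ltry.
by apply: bounded_integral => //; exact: measurable_slice.
Qed.

Let head_int_ge0 n (F : n.+1.-tuple (measurableTypeR R) -> R) x :
  tame F -> 0 <= head_int F x.
Proof.
by case=> _ F0 _ _; apply/fine_ge0/integral_ge0 => s _; rewrite lee_fin.
Qed.

Let head_int_le n (F : n.+1.-tuple (measurableTypeR R) -> R) :
  tame F -> exists C, forall x, head_int F x <= C.
Proof.
move=> tF; have [mF F0 [C FC] _] := tF; exists C => x.
rewrite -lee_fin -head_intE//.
by apply: bounded_integral => //; exact: measurable_slice.
Qed.

Let head_int_lipschitz n (F : n.+1.-tuple (measurableTypeR R) -> R) :
  tame F -> exists L, forall x y, head_int F x <= expR (L * `|x - y|) * head_int F y.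
Proof.
move=> tF; have [mF F0 _ [L FL]] := tF; exists L => x y.
rewrite -lee_fin EFinM -!head_intE//.
rewrite -ge0_integralZl//; last 2 first.
- by apply/measurable_EFinP; exact: measurable_slice.
- by move=> s _; rewrite lee_fin.
apply: ge0_le_integral => //.
- by move=> s _; rewrite lee_fin.
- by apply/measurable_EFinP; exact: measurable_slice.
- apply: measurable_funeM; apply/measurable_EFinP; exact: measurable_slice.
by move=> s _; rewrite -EFinM lee_fin -(euclidean_dist_head x y s).
Qed.

(** Boundedness makes the multiplicative modulus of continuity additive. *)
Let log_lipschitz_continuous (f : R -> R) L C :
  (forall x, 0 <= f x) -> (forall x, f x <= C) ->
  (forall x y, f x <= expR (L * `|x - y|) * f y) -> continuous f.
Proof.
move=> f0 fC fL x; have C0 : 0 <= C by exact: le_trans (f0 0) (fC 0).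
have dist y : `|f x - f y| <= C * (expR (`|L| * `|x - y|) - 1).
  have h s t : f s - f t <= C * (expR (`|L| * `|s - t|) - 1).
    apply: (@le_trans _ _ (f t * (expR (`|L| * `|s - t|) - 1))).
      rewrite mulrBr mulr1 lerD2r mulrC; apply: le_trans (fL s t) _.
      by rewrite ler_wpM2r// ler_expR ler_wpM2r// ler_norm.
    by rewrite ler_wpM2r// subr_ge0 -expR0 ler_expR mulr_ge0.
  by rewrite ler_norml lerNl opprB [in X in X && _]distrC !h.
have cvg0 : C * (expR (`|L| * `|x - y|) - 1) @[y --> x] --> (0 : R).
  have -> : (0 : R) = C * (expR (`|L| * `|x - x|) - 1).
    by rewrite subrr normr0 mulr0 expR0 subrr mulr0.
  apply: cvgMr; apply: cvgB; last exact: cvg_cst.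
  apply: (@continuous_cvg _ _ _ _ _ _ expR); first exact: continuous_expR.
  apply: cvgMr; apply: cvg_norm; apply: cvgB; [exact: cvg_cst|exact: cvg_id].
apply/cvgrPdist_le => e e0; near=> y; apply: le_trans (dist y) _.
by near: y; apply: cvgr_le cvg0 _ e0.
Unshelve. all: by end_near. Qed.

(** The integrals over the remaining coordinates are again functions to which
    the one-dimensional inequality applies, since [F (x :: -) / K x y] and
    [G (y :: -)] satisfy the hypothesis in one dimension less. *)
Theorem two_function_tensor n (F G : n.-tuple (measurableTypeR R) -> R) :
  tame F -> tame G ->
  (forall x y, F x * G y <= \prod_(i < n) K (tnth x i) (tnth y i)) ->
  (\int[P n]_x (F x)%:E * \int[P n]_x (G x)%:E <= 1)%E.
Proof.
elim: n F G => [|n IH] F G tF tG FG.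
  have [mF _ _ _] := tF; have [mG _ _ _] := tG.
  rewrite /P /= !integral_dirac//; try exact/measurable_EFinP.
  rewrite !diracT !mul1e -EFinM lee_fin.
  by have := FG [tuple] [tuple]; rewrite big_ord0.
have [mF F0 [CF FC] [LF FL]] := tF; have [mG G0 [CG GC] [LG GL]] := tG.
rewrite !integral_product_powerS//; try exact/measurable_EFinP;
  try by move=> x; rewrite lee_fin.
under eq_integral do rewrite head_intE//.
under [X in (_ * X)%E]eq_integral do rewrite head_intE//.
have [C1 hC1] := head_int_le tF; have [L1 hL1] := head_int_lipschitz tF.
have [C2 hC2] := head_int_le tG; have [L2 hL2] := head_int_lipschitz tG.
apply: two_fun.
- by move=> x; exact: head_int_ge0.
- by move=> x; exact: head_int_ge0.
- by apply: log_lipschitz_continuous hC1 hL1 => x; exact: head_int_ge0.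
- by apply: log_lipschitz_continuous hC2 hL2 => x; exact: head_int_ge0.
- by exists C1.
- by exists C2.
move=> x y.
have Ki0 : 0 <= (K x y)^-1 by rewrite invr_ge0 ltW.
have tFx : tame (fun s => (K x y)^-1 * F [tuple of x :: s]).
  split.
  - by apply: measurable_funM => //; exact: measurable_slice.
  - by move=> s; rewrite mulr_ge0.
  - by exists ((K x y)^-1 * CF) => s; rewrite ler_wpM2l.
  - by exists LF => s t; rewrite mulrCA ler_wpM2l// -(euclidean_dist_tail x).
have tGy : tame (fun s => G [tuple of y :: s]).
  split.
  - exact: measurable_slice.
  - by move=> s.
  - by exists CG.
  - by exists LG => s t; rewrite -(euclidean_dist_tail y).
have := IH _ _ tFx tGy; under eq_integral do rewrite EFinM.
rewrite ge0_integralZl//; last 2 first.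
- by apply/measurable_EFinP; exact: measurable_slice.
- by move=> s _; rewrite lee_fin.
rewrite !head_intE// -!EFinM lee_fin -mulrA mulrC ler_pdivrMr// mul1r; apply.
move=> s t; rewrite -mulrA mulrC ler_pdivrMr//.
have := FG [tuple of x :: s] [tuple of y :: t].
rewrite big_ord_recl !tnth0 mulrC; under eq_bigr do rewrite !tnthS.
by rewrite mulrC [leRHS]mulrC.
Qed.

End tensorization.

(** * From coordinatewise costs to the Euclidean distance *)

Section cost.
Context {R : realType} (Phi : R -> R) (k r1 : R).
Implicit Types d r u x : R.
Hypothesis Phi_ge0 : forall x : R, 0 <= x -> 0 <= Phi x.
Hypothesis Phi_incr : forall x y : R, 0 <= x -> x <= y -> Phi x <= Phi y.
Hypothesis Phi_scale_ge : forall l x : R, 0 <= l <= 1 -> 0 <= x ->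
  l ^+ 2 * Phi x <= Phi (l * x).
Hypothesis k_gt0 : 0 < k.
Hypothesis r1_gt0 : 0 < r1.
Hypothesis Phi_r1 : Phi r1 = 1.

(** Of order [u ^+ 2] for small [u] and of order [u] for large [u]. *)
Definition cost u : R := 3 / 64 * ((u / 2) ^+ 2 / (1 + u / 2)).

(** The first term of the minimum is what the linear regime of the cost leaves,
    the second what the quadratic regime leaves. *)
Definition cost_factor : R := 3 / 64 * Num.min (1 / 4) (k ^+ 2 * r1 ^+ 2 / 8).

Lemma cost_factor_gt0 : 0 < cost_factor.
Proof.
rewrite mulr_gt0//.
by rewrite lt_min divr_gt0//= divr_gt0// mulr_gt0// exprn_gt0.
Qed.

Lemma cost_ge0 u : 0 <= u -> 0 <= cost u.
Proof.
move=> u0; have u1 : 0 <= 1 + u / 2 by lra.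
by rewrite /cost; apply: mulr_ge0 => //; apply: divr_ge0 => //; exact: sqr_ge0.
Qed.

(** Both regimes of the cost, quadratic for small gaps and linear in the gap
    for large ones, dominate a multiple of the quadratic function of [d] with
    value [Phi (r / 2)] at [d = r], because [Phi] is subquadratic. *)
Lemma cost_ge d r u : 0 <= d <= r -> r1 <= r ->
  Phi (d / 2) <= u -> k * d <= u ->
  cost_factor * Phi (r / 2) * (d / r) ^+ 2 <= cost u.
Proof.
move=> /andP[d0 dr] r1r hu ku; have r0 : 0 < r by exact: lt_le_trans r1r.
have dr01 : 0 <= d / r <= 1.
  by rewrite divr_ge0 ?(ltW r0)//= ler_pdivrMr// mul1r.
have u0 : 0 <= u by apply: le_trans ku; rewrite mulr_ge0// ltW.
have r20 : 0 <= r / 2 by lra.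
have Pr0 : 0 <= Phi (r / 2) by exact: Phi_ge0.
rewrite /cost_factor /cost; set m := Num.min _ _.
rewrite -[3 / 64 * m * _]mulrA -[3 / 64 * (m * _) * _]mulrA ler_pM2l; last by lra.
have [v1|v1] := leP (u / 2) 1.
  (* Small gap: [Phi r / r ^+ 2 <= 1 / r1 ^+ 2], by subquadraticity. *)
  apply: (@le_trans _ _ ((u / 2) ^+ 2 / 2)); last first.
    have v0 : 0 < 1 + u / 2 by lra.
    by rewrite ler_wpM2l ?sqr_ge0// lef_pV2 ?posrE//; lra.
  have h1 : Phi (r / 2) * r1 ^+ 2 <= r ^+ 2.
    have h : (r1 / r) ^+ 2 * Phi r <= 1.
      rewrite -[leRHS]Phi_r1; have := @Phi_scale_ge (r1 / r) r.
      rewrite divfK ?gt_eqF//; apply; last exact: ltW.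
      by rewrite divr_ge0 ?(ltW r0) ?(ltW r1_gt0)//= ler_pdivrMr// mul1r.
    have h' : Phi r * r1 ^+ 2 <= r ^+ 2.
      by move: h; rewrite expr_div_n mulrAC ler_pdivrMr ?exprn_gt0// mul1r mulrC.
    apply: le_trans h'; rewrite ler_wpM2r ?sqr_ge0//.
    by apply: Phi_incr => //; lra.
  apply: (@le_trans _ _ (k ^+ 2 * d ^+ 2 / 8)); last first.
    have : (k * d) ^+ 2 <= u ^+ 2.
      by rewrite lerXn2r// nnegrE// mulr_ge0// ltW.
    by rewrite !exprMn; lra.
  apply: (@le_trans _ _ (k ^+ 2 * r1 ^+ 2 / 8 * Phi (r / 2) * (d / r) ^+ 2)).
    rewrite ler_wpM2r ?sqr_ge0// ler_wpM2r//.
    by rewrite /m ge_min lexx orbT.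
  rewrite (_ : _ * (d / r) ^+ 2 =
    (k ^+ 2 * d ^+ 2 / 8) * ((Phi (r / 2) * r1 ^+ 2) / r ^+ 2)); last first.
    by field; rewrite gt_eqF.
  apply: ler_piMr; last by rewrite ler_pdivrMr ?exprn_gt0// mul1r.
  by rewrite divr_ge0// mulr_ge0// sqr_ge0.
(* Large gap: [Phi (d / 2)] itself is compared with [Phi (r / 2)]. *)
apply: (@le_trans _ _ (u / 4)); last first.
  rewrite expr2 -mulrA -[leLHS]mulr1.
  rewrite (_ : u / 4 * 1 = u / 2 * (1 / 2)); last by field.
  by rewrite ler_wpM2l//; [lra|rewrite ler_pdivlMr; lra].
apply: (@le_trans _ _ (1 / 4 * Phi (r / 2) * (d / r) ^+ 2)).
  by rewrite ler_wpM2r ?sqr_ge0// ler_wpM2r// /m ge_min lexx.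
have := Phi_scale_ge dr01 r20.
rewrite (_ : d / r * (r / 2) = d / 2); last by field; rewrite gt_eqF.
by lra.
Qed.

(** Adding the coordinatewise bounds at [r] equal to the Euclidean distance
    makes the squares sum up to one; the subtracted constant takes care of
    distances below [r1]. *)
Lemma sum_cost_ge n (x y : n.-tuple R) (u : 'I_n -> R) :
  (forall i, Phi (`|tnth x i - tnth y i| / 2) <= u i) ->
  (forall i, k * `|tnth x i - tnth y i| <= u i) ->
  cost_factor * (Phi (euclidean_dist x y / 2) - 1) <= \sum_(i < n) cost (u i).
Proof.
move=> hu ku; set r := euclidean_dist x y.
have r0 : 0 <= r by exact: sqrtr_ge0.
have rE : r ^+ 2 = \sum_(i < n) `|tnth x i - tnth y i| ^+ 2.
  rewrite /r /euclidean_dist sqr_sqrtr; last first.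
    by apply: sumr_ge0 => i _; exact: sqr_ge0.
  by apply: eq_bigr => i _; rewrite real_normK ?num_real.
clearbody r.
have u0 i : 0 <= u i by apply: le_trans (ku i); rewrite mulr_ge0// ltW.
have [r1r|/ltW rr1] := leP r1 r; last first.
  apply: (@le_trans _ _ 0); last by apply: sumr_ge0 => i _; exact: cost_ge0.
  rewrite mulr_ge0_le0 ?(ltW cost_factor_gt0)// subr_le0 -[leRHS]Phi_r1.
  by apply: Phi_incr => //; lra.
have rp : 0 < r by exact: lt_le_trans r1r.
have dr i : `|tnth x i - tnth y i| <= r.
  rewrite -(@ler_pXn2r _ 2)// ?nnegrE// rE (bigD1 i)//= lerDl.
  by apply: sumr_ge0 => j _; exact: sqr_ge0.
apply: (@le_trans _ _ (cost_factor * Phi (r / 2))).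
  by rewrite ler_pM2l ?cost_factor_gt0//; lra.
apply: (@le_trans _ _ (\sum_(i < n)
    cost_factor * Phi (r / 2) * (`|tnth x i - tnth y i| / r) ^+ 2)).
  rewrite -mulr_sumr; under eq_bigr do rewrite expr_div_n.
  by rewrite -mulr_suml -rE divff ?mulr1// expf_neq0// gt_eqF.
apply: ler_sum => i _; apply: cost_ge => //.
by rewrite normr_ge0 dr.
Qed.

(** The left-hand side is the linear function of [r] whose graph is the chord of
    [Psi] from 0 to [T / 2]: for smaller [r] it is at most its value at [T / 2],
    and for larger [r] it lies below [Psi]. *)
Lemma secant_le (c2 T r : R) (Psi := fun s => c2 * Phi (s / 2)) :
  (forall l x : R, 1 <= l -> 0 <= x -> l * Phi x <= Phi (l * x)) ->
  0 < c2 -> 0 < T -> 0 <= r ->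
  2 * Psi (T / 2) / T * r <= Psi r + Psi (T / 2).
Proof.
move=> expand c20 T0 r0.
have Psi0 s : 0 <= s -> 0 <= Psi s.
  by move=> s0; rewrite /Psi mulr_ge0 ?(ltW c20)// Phi_ge0//; lra.
have P1 := Psi0 _ r0; have P2 : 0 <= Psi (T / 2) by apply: Psi0; lra.
rewrite (_ : 2 * Psi (T / 2) / T * r = (r / (T / 2)) * Psi (T / 2)); last first.
  by field; rewrite gt_eqF.
have [rT|Tr] := leP r (T / 2).
  apply: (@le_trans _ _ (Psi (T / 2))); last by lra.
  rewrite ler_piMl// ler_pdivrMr ?divr_gt0// mul1r.
  exact: rT.
apply: (@le_trans _ _ (Psi r)); last by lra.
rewrite /Psi mulrCA ler_pM2l//.
have h : 1 <= r / (T / 2) by rewrite ler_pdivlMr ?divr_gt0// mul1r ltW.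
have T4 : 0 <= T / 2 / 2 by lra.
have := expand _ _ h T4.
by rewrite (_ : r / (T / 2) * (T / 2 / 2) = r / 2)//; field; rewrite gt_eqF.
Qed.

End cost.

(** * Measurability of Lipschitz functions *)

Section lipschitz.
Context {R : realType} (n : nat).
Implicit Types (x y q : n.-tuple R) (h : n.-tuple R -> R).

Lemma euclidean_distC x y : euclidean_dist x y = euclidean_dist y x.
Proof.
rewrite /euclidean_dist; congr Num.sqrt; apply: eq_bigr => i _.
by rewrite -opprB sqrrN.
Qed.

Lemma euclidean_dist_ge0 x y : 0 <= euclidean_dist x y.
Proof. exact: sqrtr_ge0. Qed.

Lemma measurable_euclidean_dist y :
  measurable_fun [set: n.-tuple (measurableTypeR R)] (fun x => euclidean_dist x y).
Proof.
apply: (@measurableT_comp _ _ _ _ _ _ (@Num.sqrt R)).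
  by apply: continuous_measurable_fun; exact: sqrt_continuous.
apply: measurable_sum => i; apply: measurable_funX.
apply: measurable_funB; last exact: measurable_cst.
exact: measurable_tnth.
Qed.

Lemma rational_points_dense x (e : R) : 0 < e ->
  exists q : n.-tuple rat, euclidean_dist x [tuple ratr (tnth q i) | i < n] < e.
Proof.
move=> e0; pose d := e / n.+1%:R; have d0 : 0 < d by rewrite divr_gt0.
have /choice[q qP] : forall i : 'I_n, exists q : rat,
    ratr q \in `]tnth x i - d, tnth x i + d[.
  by move=> i; apply: rat_in_itvoo; lra.
exists [tuple q i | i < n].
rewrite -(@ltr_pXn2r _ 2)// ?nnegrE ?euclidean_dist_ge0 ?(ltW e0)//.
rewrite sqr_sqrtr; last by apply: sumr_ge0 => i _; exact: sqr_ge0.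
apply: (@le_lt_trans _ _ (\sum_(i < n) d ^+ 2)).
  apply: ler_sum => i _; rewrite !tnth_mktuple -real_normK ?num_real//.
  rewrite lerXn2r ?nnegrE ?(ltW d0)// ler_norml.
  by have := qP i; rewrite in_itv/= => /andP[h1 h2]; apply/andP; split; lra.
rewrite sumr_const card_ord -mulr_natr /d expr_div_n mulrAC ltr_pdivrMr ?exprn_gt0//.
rewrite ltr_pM2l ?exprn_gt0// -natrX ltr_nat.
by apply: (leq_trans (ltnSn n)); rewrite expnS expn1; exact: leq_pmulr.
Qed.

(** A Lipschitz function is the infimum of the cones based at the rational
    points; this is what makes it measurable for the product sigma-algebra,
    which is generated by coordinates and not by open sets. *)
Lemma lipschitz1_measurable h : lipschitz1 h ->
  measurable_fun [set: n.-tuple (measurableTypeR R)] h.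
Proof.
move=> hL; apply: (measurability _ (RGenInftyO.measurableE R)).
move=> _ [_ [a ->] <-]; rewrite setTI.
pose pt (q : n.-tuple rat) : n.-tuple R := [tuple ratr (tnth q i) | i < n].
rewrite (_ : h @^-1` _ =
    \bigcup_(q : n.-tuple rat) [set x | h (pt q) + euclidean_dist x (pt q) < a]).
  apply: countable_bigcupT_measurable; first exact: countableP.
  move=> q; rewrite -[X in measurable X]setTI.
  have mf : measurable_fun [set: n.-tuple (measurableTypeR R)]
      (fun x => h (pt q) + euclidean_dist x (pt q)).
    apply: measurable_funD; first exact: measurable_cst.
    exact: measurable_euclidean_dist.
  rewrite (_ : [set x | _] =
    (fun x => h (pt q) + euclidean_dist x (pt q)) @^-1` `]-oo, a[%classic).
    exact: mf.
  by apply/seteqP; split => x /=; rewrite in_itv.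
apply/seteqP; split => x /=.
  rewrite in_itv/= => ha.
  have e0 : 0 < (a - h x) / 2 by lra.
  have [q hq] := rational_points_dense x e0.
  exists q => //=; have := hL (pt q) x.
  rewrite euclidean_distC ler_norml => /andP[_ h2].
  by move: hq; rewrite -/(pt q); lra.
move=> [q _ /=]; rewrite in_itv/= => ha; have := hL x (pt q).
by rewrite ler_norml => /andP[_ h2]; lra.
Qed.

End lipschitz.

(** * Exponential moments and deviations *)

Section exponential_moments.
Context d (T : measurableType d) {R : realType} (P : probability T R).
Local Open Scope ereal_scope.

Lemma integral_gt0 (f : T -> R) : measurable_fun [set: T] f ->
  (forall x, 0 < f x)%R -> 0 < \int[P]_x (f x)%:E.
Proof.
move=> mf f0; rewrite lt_neqAle integral_ge0 ?andbT; last first.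
  by move=> x _; rewrite lee_fin ltW.
apply/eqP => /esym If0.
have : ae_eq P [set: T] (EFin \o f) (cst 0).
  apply/(ae_eq_integral_abs P measurableT); first exact/measurable_EFinP.
  rewrite -[RHS]If0; apply: eq_integral => x _.
  by rewrite /= ger0_norm// ltW.
move=> [N [mN PN0 sub]]; have : P [set: T] <= P N.
  apply: le_measure; rewrite ?inE// => x _; apply: sub => /= /(_ I).
  by move=> /eqP; rewrite eqe gt_eqF.
by rewrite PN0 [X in X <= _]probability_setT leNgt lte01.
Qed.

Let cvg_integral_nondecreasing (f_ : nat -> T -> R) (f : T -> R) :
  (forall m, measurable_fun [set: T] (f_ m)) -> (forall m x, 0 <= f_ m x)%R ->
  (forall x, {homo f_ ^~ x : m k / (m <= k)%N >-> (m <= k)%R}) ->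
  (forall x, exists N, forall m, (N <= m)%N -> f_ m x = f x) ->
  \int[P]_x (f_ m x)%:E @[m --> \oo] --> \int[P]_x (f x)%:E.
Proof.
move=> mf f0 fhomo fev.
have -> : \int[P]_x (f x)%:E = \int[P]_x limn (fun m => (f_ m x)%:E).
  apply: eq_integral => x _; apply/esym/cvg_lim => //; have [N hN] := fev x.
  apply: cvg_near_cst; exists N => // m /= Nm; by rewrite hN.
apply: cvg_monotone_convergence => //.
- by move=> m; exact/measurable_EFinP.
- by move=> m x _; rewrite lee_fin.
- by move=> x _ m k mk; rewrite lee_fin; exact: fhomo.
Qed.

(** When the first limit is infinite, all the integrals of the second sequence
    have to vanish; the convention [+oo * 0 = 0] then gives the bound. *)
Lemma product_of_monotone_limits (f_ g_ : nat -> T -> R) (f g : T -> R) (C : R) :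
  (0 <= C)%R ->
  (forall m, measurable_fun [set: T] (f_ m)) -> (forall m x, 0 <= f_ m x)%R ->
  (forall x, {homo f_ ^~ x : m k / (m <= k)%N >-> (m <= k)%R}) ->
  (forall x, exists N, forall m, (N <= m)%N -> f_ m x = f x) ->
  (forall m, measurable_fun [set: T] (g_ m)) -> (forall m x, 0 <= g_ m x)%R ->
  (forall x, {homo g_ ^~ x : m k / (m <= k)%N >-> (m <= k)%R}) ->
  (forall x, exists N, forall m, (N <= m)%N -> g_ m x = g x) ->
  (forall k, \int[P]_x (g_ k x)%:E \is a fin_num) ->
  (forall m k, \int[P]_x (f_ m x)%:E * \int[P]_x (g_ k x)%:E <= C%:E) ->
  \int[P]_x (f x)%:E * \int[P]_x (g x)%:E <= C%:E.
Proof.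
move=> C0 mf f0 fh fe mg g0 gh ge gfin fg.
have cf := cvg_integral_nondecreasing mf f0 fh fe.
have cg := cvg_integral_nondecreasing mg g0 gh ge.
have Af k : \int[P]_x (f x)%:E * \int[P]_x (g_ k x)%:E <= C%:E.
  have h := cvgeZr (gfin k) cf.
  rewrite -(cvg_lim _ h)//; apply: lime_le.
    by apply/cvg_ex; eexists; exact: h.
  by near=> m; exact: fg.
have fge0 x : (0 <= f x)%R by have [N hN] := fe x; rewrite -(hN N).
have If0 : 0 <= \int[P]_x (f x)%:E.
  by apply: integral_ge0 => x _; rewrite lee_fin.
have [ffin|finfty] := boolP (\int[P]_x (f x)%:E \is a fin_num).
  have h := cvgeZl ffin cg.
  rewrite -(cvg_lim _ h)//; apply: lime_le.
    by apply/cvg_ex; eexists; exact: h.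
  by near=> m; exact: Af.
have {}finfty : \int[P]_x (f x)%:E = +oo.
  by move: finfty If0; case: (\int[P]_x (f x)%:E).
have gk0 k : \int[P]_x (g_ k x)%:E = 0.
  apply/eqP; rewrite eq_le integral_ge0 ?andbT; last first.
    by move=> x _; rewrite lee_fin.
  rewrite leNgt; apply/negP => gpos; have := Af k.
  by rewrite finfty gt0_mulye.
suff -> : \int[P]_x (g x)%:E = 0 by rewrite mule0 lee_fin.
rewrite -(cvg_lim _ cg)//; apply: lim_near_cst => //.
by near=> m; exact: gk0.
Unshelve. all: by end_near. Qed.

Section laplace.
Context (h : T -> R) (l W : R).
Hypothesis mh : measurable_fun [set: T] h.
Hypothesis l0 : (0 < l)%R.
Hypothesis hAB : \int[P]_x (expR (l * h x))%:E *
  \int[P]_x (expR (- (l * h x)))%:E <= (expR W)%:E.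

Let mplus : measurable_fun [set: T] (fun x => expR (l * h x)).
Proof.
by apply: (measurableT_comp (@measurable_expR R)); exact: measurable_funM.
Qed.

Let mminus : measurable_fun [set: T] (fun x => expR (- (l * h x))).
Proof.
apply: (measurableT_comp (@measurable_expR R)).
by apply: measurableT_comp => //; exact: measurable_funM.
Qed.

Let A_gt0 : 0 < \int[P]_x (expR (l * h x))%:E.
Proof. by apply: integral_gt0 => // x; exact: expR_gt0. Qed.

Let B_gt0 : 0 < \int[P]_x (expR (- (l * h x)))%:E.
Proof. by apply: integral_gt0 => // x; exact: expR_gt0. Qed.

Let A_lty : \int[P]_x (expR (l * h x))%:E < +oo.
Proof.
rewrite ltey; apply/eqP => AE; move: hAB; rewrite AE gt0_mulye//.
Qed.

Let B_lty : \int[P]_x (expR (- (l * h x)))%:E < +oo.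
Proof.
rewrite ltey; apply/eqP => BE; move: hAB; rewrite BE gt0_muley//.
Qed.

Let iplus : P.-integrable [set: T] (EFin \o (fun x => expR (l * h x))).
Proof.
apply/integrableP; split; first exact/measurable_EFinP.
by under eq_integral do rewrite /= ger0_norm ?expR_ge0//.
Qed.

Let iminus : P.-integrable [set: T] (EFin \o (fun x => expR (- (l * h x)))).
Proof.
apply/integrableP; split; first exact/measurable_EFinP.
by under eq_integral do rewrite /= ger0_norm ?expR_ge0//.
Qed.

(** Since both exponential moments are positive, a bound on their product makes
    each of them finite. *)
Lemma laplace_integrable : P.-integrable [set: T] (EFin \o h).
Proof.
have isum := integrableD measurableT iplus iminus.
apply: (le_integrable measurableT _ _ (integrableZl measurableT l^-1 isum)).
  exact/measurable_EFinP.
move=> x _ /=; rewrite lee_fin [X in (_ <= X)%R]ger0_norm; last first.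
  by rewrite mulr_ge0 ?invr_ge0 ?(ltW l0)// addr_ge0 ?expR_ge0.
rewrite ler_pdivlMl// -[X in (X * _)%R](ger0_norm (ltW l0)) -normrM.
have h1 := expR_ge1Dx (l * h x); have h2 := expR_ge1Dx (- (l * h x)).
have p1 := expR_ge0 (l * h x); have p2 := expR_ge0 (- (l * h x)).
by rewrite ler_norml; apply/andP; split; lra.
Qed.

(** Jensen's inequality, in the form [1 - s <= expR (- s)], bounds one of the
    two exponential moments of a centered function below by 1. *)
Lemma laplace_chernoff (t : R) : (\int[P]_x h x = 0)%R ->
  P [set x | (t <= h x)%R] <= (expR (W - l * t))%:E.
Proof.
move=> h0; have ih := laplace_integrable.
have ilh : P.-integrable [set: T] (EFin \o (fun x => l * h x)%R).
  exact: (integrableZl measurableT l ih).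
have i1 : P.-integrable [set: T] (EFin \o (fun=> 1%R : R)).
  exact: finite_measure_integrable_cst.
have B1 : 1 <= \int[P]_x (expR (- (l * h x)))%:E.
  rewrite -[leRHS]fineK; last by rewrite ge0_fin_numE// ltW.
  have E1 : (\int[P]_x (1 - l * h x) = 1)%R.
    rewrite RintegralB// RintegralZl// h0 mulr0 subr0 Rintegral_cst// mul1r.
    by rewrite [X in fine X]probability_setT.
  rewrite lee_fin -[leLHS]E1; apply: le_Rintegral => //.
    exact: (integrableB measurableT i1 ilh).
  by move=> x Tx; exact: expR_ge1Dx.
have A1 : \int[P]_x (expR (l * h x))%:E <= (expR W)%:E.
  by apply: le_trans hAB; rewrite lee_pemulr// ltW.
have mS : measurable [set x | (t <= h x)%R].
  rewrite -[X in measurable X]setTI.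
  rewrite (_ : [set x | _] = h @^-1` `[t, +oo[%classic); first exact: mh.
  by apply/seteqP; split => x /=; rewrite in_itv/= andbT.
have : (expR (l * t))%:E * P [set x | (t <= h x)%R] <= (expR W)%:E.
  apply: le_trans A1.
  rewrite -[X in _ * P X]setIT -integral_indic//.
  rewrite -ge0_integralZl ?lee_fin ?expR_ge0//; last first.
    by apply/measurable_EFinP; exact: measurable_indic.
  apply: ge0_le_integral => //.
  - by apply: measurable_funeM; apply/measurable_EFinP; exact: measurable_indic.
  - exact/measurable_EFinP.
  move=> x _; rewrite -EFinM lee_fin indicE; case: (boolP (x \in _)) => xS.
    rewrite mulr1 ler_expR ler_pM2l//.
    by move: xS; rewrite inE.
  by rewrite mulr0 expR_ge0.
by rewrite expRB EFinM lee_pdivlMr ?expR_gt0// muleC.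
Qed.

End laplace.
End exponential_moments.

Section lipschitz_laplace.
Context {R : realType} (mu : probability (measurableTypeR R) R).
Context (K : R -> R -> R).
Hypothesis K_gt0 : forall x y, 0 < K x y.
Hypothesis two_fun : forall F G : R -> R,
  (forall x, 0 <= F x) -> (forall x, 0 <= G x) ->
  continuous F -> continuous G ->
  (exists C, forall x, F x <= C) -> (exists C, forall x, G x <= C) ->
  (forall x y, F x * G y <= K x y) ->
  (\int[mu]_x (F x)%:E * \int[mu]_x (G x)%:E <= 1)%E.
Context (n : nat) (h : n.-tuple (measurableTypeR R) -> R) (l W : R).
Hypothesis hL : lipschitz1 h.
Hypothesis l_ge0 : 0 <= l.
Hypothesis hK : forall x y,
  expR (l * (h x - h y)) <= expR W * \prod_(i < n) K (tnth x i) (tnth y i).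

Let up m x : R := expR (l * Num.min (h x) m%:R).
Let down m x : R := expR (- (l * Num.max (h x) (- m%:R))).

Let mup m : measurable_fun [set: n.-tuple (measurableTypeR R)] (up m).
Proof.
apply: (measurableT_comp (@measurable_expR R)); apply: measurable_funM => //.
by apply: measurable_minr => //; exact: lipschitz1_measurable.
Qed.

Let mdown m : measurable_fun [set: n.-tuple (measurableTypeR R)] (down m).
Proof.
apply: (measurableT_comp (@measurable_expR R)); apply: measurableT_comp => //.
apply: measurable_funM => //.
by apply: measurable_maxr => //; exact: lipschitz1_measurable.
Qed.

Let up_le m x : up m x <= expR (l * m%:R).
Proof. by rewrite ler_expR ler_wpM2l// ge_min lexx orbT. Qed.

Let down_le m x : down m x <= expR (l * m%:R).
Proof.
by rewrite ler_expR -mulrN ler_wpM2l// lerNl le_max lexx orbT.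
Qed.

Let up_lipschitz m x y : up m x <= expR (l * euclidean_dist x y) * up m y.
Proof.
rewrite -expRD ler_expR -mulrDr ler_wpM2l//.
have := hL x y; rewrite ler_norml => /andP[_ hxy].
have d0 := euclidean_dist_ge0 x y.
by case: (leP (h x) m%:R) => h1; case: (leP (h y) m%:R) => h2; lra.
Qed.

Let down_lipschitz m x y : down m x <= expR (l * euclidean_dist x y) * down m y.
Proof.
rewrite -expRD ler_expR -!mulrN -mulrDr ler_wpM2l//.
have := hL x y; rewrite ler_norml => /andP[hxy _].
have d0 := euclidean_dist_ge0 x y.
by case: (leP (h x) (- m%:R)) => h1; case: (leP (h y) (- m%:R)) => h2; lra.
Qed.

Let up_down m k x y :
  expR (- W) * up m x * down k y <= \prod_(i < n) K (tnth x i) (tnth y i).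
Proof.
rewrite -mulrA expRN ler_pdivrMl ?expR_gt0//; apply: le_trans (hK x y).
rewrite -expRD ler_expR -mulrN -mulrDr ler_wpM2l//.
by apply: lerB; [rewrite ge_min lexx|rewrite le_max lexx].
Qed.

Let tame_up m : tame (fun x => expR (- W) * up m x).
Proof.
have e0 := expR_ge0 (- W); split.
- by apply: measurable_funM => //; exact: mup.
- by move=> x; rewrite mulr_ge0 ?expR_ge0.
- by exists (expR (- W) * expR (l * m%:R)) => x; rewrite ler_wpM2l.
- by exists l => x y; rewrite mulrCA ler_wpM2l.
Qed.

Let tame_down m : tame (down m).
Proof.
split; [exact: mdown|by move=> x; exact: expR_ge0| |].
- by exists (expR (l * m%:R)).
- by exists l.
Qed.

(** The exponentials of [h] are unbounded; cutting [h] from above in the first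
    and from below in the second only decreases the product [F x * G y]. *)
Lemma lipschitz_laplace :
  (\int[product_power mu n]_x (expR (l * h x))%:E *
   \int[product_power mu n]_x (expR (- (l * h x)))%:E <= (expR W)%:E)%E.
Proof.
apply: (@product_of_monotone_limits _ _ _ _ up down) => //.
- by move=> m x; exact: expR_ge0.
- move=> x m k mk; rewrite ler_expR ler_wpM2l// le_min ge_min lexx/=.
  by rewrite ge_min ler_nat mk orbT.
- move=> x; exists (Num.bound (h x)) => m Nm; rewrite /up min_l//.
  apply: le_trans (ltW (unstable.ltr_bound (h x))) _.
  by rewrite ler_nat.
- by move=> m x; exact: expR_ge0.
- move=> x m k mk; rewrite ler_expR lerN2 ler_wpM2l// ge_max le_max lexx/=.
  by rewrite le_max lerN2 ler_nat mk orbT.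
- move=> x; exists (Num.bound (h x)) => m Nm; rewrite /down max_l//.
  rewrite lerNl; apply: le_trans (ltW (unstable.ltrNbound (h x))) _.
  by rewrite ler_nat.
- move=> k; rewrite ge0_fin_numE; last first.
    by apply: integral_ge0 => x _; rewrite lee_fin expR_ge0.
  apply: (@le_lt_trans _ _
    (\int[product_power mu n]_x (cst (expR (l * k%:R))%:E) x)%E).
    apply: ge0_le_integral => //.
    + by move=> x _; rewrite lee_fin expR_ge0.
    + exact/measurable_EFinP.
    + by move=> x _; rewrite lee_fin.
  by rewrite integral_cst// [X in (_ * X)%E]probability_setT mule1 ltry.
move=> m k.
have := two_function_tensor K_gt0 two_fun (tame_up m) (tame_down k) (up_down m k).
under eq_integral do rewrite EFinM.
rewrite ge0_integralZl ?lee_fin ?expR_ge0//; last 2 first.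
- exact/measurable_EFinP.
- by move=> x _; rewrite lee_fin expR_ge0.
by rewrite -muleA expRN lee_pdivrMl ?expR_gt0// mule1.
Qed.

End lipschitz_laplace.

(** * Concentration for the product measure *)

Lemma kernel_ge_cost (R : realType) (p : R -> R) (x y : R) :
  expR (cost (log_gap p x y)) <= gain_kernel p x y.
Proof.
rewrite /gain_kernel /cost /log_gap.
have g1 := gain_ge1 (ln (primitive p x) - ln (primitive p y)).
have g2 := gain_ge1 (ln (1 - primitive p x) - ln (1 - primitive p y)).
case: (leP `|ln (primitive p x) - _|) => _.
  have := gain_ge_expR (ln (1 - primitive p x) - ln (1 - primitive p y)).
  move=> /le_trans; apply; lra.
have := gain_ge_expR (ln (primitive p x) - ln (primitive p y)).
by move=> /le_trans; apply; lra.
Qed.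

Lemma kernel_gt0 (R : realType) (p : R -> R) (x y : R) : 0 < gain_kernel p x y.
Proof. exact: lt_le_trans (expR_gt0 _) (kernel_ge_cost p x y). Qed.

Section normalization.
Context {R : realType} (Phi : R -> R).
Hypothesis Phi_ge0 : forall x : R, 0 <= x -> 0 <= Phi x.
Context (mu : probability (measurableTypeR R) R).
Hypothesis muE :
  forall A : set (measurableTypeR R), measurable A -> mu A = mu_ Phi A.

(** The normalizing constant is nonzero because [mu] has mass one; with the
    convention [0^-1 = 0] and [fine +oo = 0] this also excludes a divergent
    integral. *)
Lemma Z_gt0 : 0 < Z_ Phi.
Proof.
rewrite lt_neqAle; apply/andP; split; last first.
  by apply: Rintegral_ge0 => x _; exact: expR_ge0.
apply/eqP => Z0; have : mu [set: _] = 0%E.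
  rewrite muE// /mu_ -Z0 invr0; apply: integral0_eq => x _.
  by rewrite mul0r.
by rewrite [X in X = _]probability_setT => /eqP; rewrite eqe oner_eq0.
Qed.

Lemma growth_not_null : exists z, 0 <= z /\ 0 < Phi z.
Proof.
apply: contrapT => /forallNP nz.
have P0 x : Phi `|x| = 0.
  have := nz `|x|; rewrite normr_ge0 => /not_andP[//|/negP].
  by rewrite -leNgt => h; apply/eqP; rewrite eq_le h Phi_ge0.
have := Z_gt0; rewrite /Z_.
have -> : (fun x : R => expR (- Phi `|x|)) = cst 1.
  by apply/funext => x; rewrite P0 oppr0 expR0.
have muT : @lebesgue_measure R [set: R] = +oo%E.
  by rewrite -set_itvNyy lebesgue_measure_itv.
by rewrite Rintegral_cst// [X in fine X]muT mulr0 ltxx.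
Qed.

End normalization.

Theorem corollary2 (R : realType) (Phi : R -> R)
    (Phi_ge0 : forall x, 0 <= x -> 0 <= Phi x)
    (Phi_incr : forall x y, 0 <= x -> x <= y -> Phi x <= Phi y)
    (Phi_convex : convex_function (`[0, +oo[ : set R) Phi)
    (Phi0 : Phi 0 = 0)
    (mu : probability (measurableTypeR R) R)
    (muE : forall A : set (measurableTypeR R), measurable A -> mu A = mu_ Phi A)
    (Phi_C2 : C2_on `[inverse_on_Rplus Phi 1, +oo[ Phi)
    (sqrt_Phi_concave :
      concave_function `[0, +oo[ (fun x => Num.sqrt (Phi x))) :
  exists2 c : R, 0 < c &
    forall n : nat, (1 <= n)%N ->
    forall h : n.-tuple (measurableTypeR R) -> R, lipschitz1 h ->
      let mun := product_power mu n in
      let mean := \int[mun]_x h x in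
      mun.-integrable [set: n.-tuple (measurableTypeR R)] (EFin \o h) /\
      forall t : R,
        Num.max (2 * inverse_on_Rplus Phi 1)
                (right_derivative Phi (inverse_on_Rplus Phi 1))^-1 <= t ->
        (mun [set x | (t * Num.sqrt c <= h x - mean)%R]
           <= (expR (- (Num.sqrt 2 * Phi (t / 2))))%:E)%E.
Proof.
have Z0 := Z_gt0 muE.
have [z [z0 Phiz]] := growth_not_null Phi_ge0 muE.
have [r1_gt0 Phi_r1] := growth_inverse1 Phi_ge0 Phi_incr Phi_convex Phi0
  sqrt_Phi_concave z0 Phiz.
set r1 := inverse_on_Rplus Phi 1 in r1_gt0 Phi_r1 *.
have expand := growth_expand Phi_convex Phi0.
pose p0 := (Z_ Phi)^-1; have p0_gt0 : 0 < p0 by rewrite invr_gt0.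
pose p (x : R) := p0 * expR (- Phi `|x|).
have p_gt0 (x : R) : 0 < p x by rewrite mulr_gt0 ?expR_gt0.
have p_cont : continuous p.
  move=> x; apply: cvgMr; apply: continuous_comp; last exact: continuous_expR.
  apply: cvgN; exact: growth_continuous.
have mupE (A : set (measurableTypeR R)) : measurable A ->
    mu A = (\int[lebesgue_measure]_(x in A) (p x)%:E)%E by move=> /muE.
have two_fun (F G : R -> R) (F0 : forall x : R, 0 <= F x)
    (G0 : forall x : R, 0 <= G x)
    (cF : continuous F) (cG : continuous G) (bF : exists C, forall x, F x <= C)
    (bG : exists C, forall x, G x <= C)
    (FG : forall x y, F x * G y <= gain_kernel p x y) :=
  two_function_inequality p_gt0 p_cont mupE F0 G0 cF cG bF bG FG.
pose k := p0 / 2; have k_gt0 : 0 < k by rewrite divr_gt0.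
pose c2 := cost_factor k r1.
have c2_gt0 : 0 < c2 by exact: cost_factor_gt0.
have gap (x y : R) := log_gap_ge Phi_incr (growth_superadd Phi_convex Phi0)
  p0_gt0 (fun x => erefl (p x)) p_cont mupE x y.
have prod_kernel n (x y : n.-tuple R) :
    expR (c2 * (Phi (euclidean_dist x y / 2) - 1)) <=
    \prod_(i < n) gain_kernel p (tnth x i) (tnth y i).
  apply: (@le_trans _ _ (\prod_(i < n)
      expR (cost (log_gap p (tnth x i) (tnth y i))))); last first.
    by apply: ler_prod => i _; rewrite expR_ge0 kernel_ge_cost.
  rewrite -expR_sum ler_expR; apply: (sum_cost_ge Phi_ge0 Phi_incr
    (growth_scale_ge Phi_ge0 Phi0 sqrt_Phi_concave) k_gt0 r1_gt0 Phi_r1) => i.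
    by have [] := gap (tnth x i) (tnth y i).
  have [_] := gap (tnth x i) (tnth y i); apply: le_trans.
  by rewrite /k mulrAC mulrA.
pose Psi (s : R) := c2 * Phi (s / 2).
have Psi_ge0 (s : R) : 0 <= s -> 0 <= Psi s.
  by move=> s0; rewrite mulr_ge0 ?(ltW c2_gt0)// Phi_ge0// divr_ge0.
(* The slope [l] is the secant slope of [Psi] at [T / 2]; both the linear bound
   [l * r <= Psi r + Psi (T / 2)] and [l * T = 2 * Psi (T / 2)] hold for it. *)
have laplace n (h : n.-tuple (measurableTypeR R) -> R) (T : R)
    (l := 2 * Psi (T / 2) / T) : lipschitz1 h -> 0 < T ->
    (\int[product_power mu n]_x (expR (l * h x))%:E *
     \int[product_power mu n]_x (expR (- (l * h x)))%:E <=
     (expR (Psi (T / 2) + c2))%:E)%E.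
  move=> hL T0.
  have T20 : 0 <= T / 2 by rewrite divr_ge0// ltW.
  have l0 : 0 <= l by rewrite divr_ge0 ?(ltW T0)// mulr_ge0// Psi_ge0.
  apply: (lipschitz_laplace (kernel_gt0 p) two_fun hL l0) => x y.
  apply: (@le_trans _ _ (expR (Psi (T / 2) + c2) *
    expR (c2 * (Phi (euclidean_dist x y / 2) - 1)))); last first.
    by rewrite ler_pM2l ?expR_gt0.
  rewrite -expRD ler_expR.
  apply: (@le_trans _ _ (l * euclidean_dist x y)).
    rewrite ler_wpM2l//; apply: le_trans (hL x y); exact: ler_norm.
  have := secant_le Phi_ge0 expand c2_gt0 T0 (euclidean_dist_ge0 x y).
  by rewrite -/(Psi _) /l /Psi; lra.
have r1_2 : 0 < r1 / 2 by rewrite divr_gt0.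
have Psi_pos : 0 < Psi r1.
  rewrite mulr_gt0//; have h2 : 1 <= 2 :> R by lra.
  have := @growth_scale_ge _ Phi Phi_ge0 Phi0 sqrt_Phi_concave (1 / 2) r1.
  rewrite Phi_r1 mulr1 (_ : 1 / 2 * r1 = r1 / 2); last by ring.
  by move=> h; apply: lt_le_trans (h _ (ltW r1_gt0)); [lra|apply/andP; split; lra].
(* Chosen so that [c2 * (C / 2) = c2 + Num.sqrt 2]: half of the dilation pays for
   the additive constant [c2], which is at most [c2 * Phi (t / 2)]. *)
pose C := 2 + 2 * Num.sqrt 2 / c2.
have s2 : 0 <= Num.sqrt 2 :> R by exact: sqrtr_ge0.
have C2 : 2 <= C.
  rewrite /C lerDl; apply: divr_ge0; last exact: ltW.
  exact: mulr_ge0.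
have C0 : 0 < C by lra.
exists (C ^+ 2); first by rewrite exprn_gt0.
move=> n _ h hL mun mean.
have mh := lipschitz1_measurable hL.
have slope_gt0 (T : R) : 2 * r1 <= T -> 0 < 2 * Psi (T / 2) / T.
  move=> rT; have T0 : 0 < T by lra.
  rewrite divr_gt0// mulr_gt0//; apply: lt_le_trans Psi_pos _.
  by rewrite /Psi ler_pM2l//; apply: Phi_incr; lra.
have ih : mun.-integrable [set: n.-tuple (measurableTypeR R)] (EFin \o h).
  have T0 : 0 < 2 * r1 by lra.
  exact: (laplace_integrable mh (slope_gt0 _ (lexx _)) (laplace n h _ hL T0)).
split => // t; rewrite ge_max => /andP[t2r _].
have t0 : 0 < t by lra.
rewrite sqrtr_sqr (gtr0_norm C0).
pose h' x := h x - mean.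
have h'L : lipschitz1 h'.
  by move=> x y; rewrite /h' opprB addrA subrK.
have mh' := lipschitz1_measurable h'L.
have h'0 : \int[mun]_x h' x = 0.
  rewrite RintegralB//; last exact: finite_measure_integrable_cst.
  by rewrite Rintegral_cst// [X in fine X]probability_setT mulr1 subrr.
pose T := t * C.
have rT : 2 * r1 <= T.
  by apply: (le_trans t2r); rewrite ler_peMr ?(ltW t0)//; lra.
have T0 : 0 < T by lra.
apply: le_trans (laplace_chernoff mh' (slope_gt0 T rT)
  (laplace n h' T h'L T0) T h'0) _.
rewrite lee_fin ler_expR divfK ?gt_eqF//.
have t2 : 0 <= t / 2 by rewrite divr_ge0 ?(ltW t0).
have P1 : 1 <= Phi (t / 2).
  by rewrite -[leLHS]Phi_r1; apply: Phi_incr; [exact: ltW|lra].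
have P2 : C / 2 * Phi (t / 2) <= Phi (T / 2 / 2).
  rewrite (_ : T / 2 / 2 = C / 2 * (t / 2)); last by rewrite /T; field.
  by apply: expand => //; lra.
have P3 : c2 * (C / 2 * Phi (t / 2)) <= Psi (T / 2) by rewrite /Psi ler_pM2l.
have P4 : c2 * (C / 2 * Phi (t / 2)) = (c2 + Num.sqrt 2) * Phi (t / 2).
  by rewrite /C; field; rewrite gt_eqF.
have P5 : c2 * 1 <= c2 * Phi (t / 2) by rewrite ler_pM2l.
lra.
Qed.
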